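(* Let $\alpha,\beta\in\mathbb{K}$ satisfy $\alpha+\beta\neq0$, $6\alpha+\beta\neq0$, $16\alpha+\beta\neq0$, and let $\mathfrak{W}$ be the Wahlquist–Estabrook prolongation algebra of the equation $u_t=u_5+(4\alpha-6\beta)u_1u_2+(8\alpha-2\beta)u_0u_3-20\alpha\beta u_0^2u_1$ at a point $a$. Let $\mathfrak{h}$ be the Lie algebra with generators $A_0,A_1,Y$ and relations $[A_1,[A_1,[A_0,A_1]]]=0$, $4\alpha[A_0,A_1]+[A_0,[A_1,[A_0,A_1]]]=0$, $[A_1,[A_1,[A_0,[A_0,[A_0,A_1]]]]]=0$, $[A_1,[A_0,[A_0,[A_0,[A_0,A_1]]]]]-\beta[A_0,[A_0,[A_0,A_1]]]+\frac12[A_0,[A_1,[A_0,[A_0,[A_0,A_1]]]]]=0$, $[A_1,Y]+[A_0,[A_0,[A_0,[A_0,[A_0,A_1]]]]]=0$, $[A_0,Y]=0$. Then $\mathfrak{W}\cong\mathfrak{h}$. Moreover: (1) If $\alpha\neq0$, then $\mathfrak{h}$ is isomorphic to $\mathfrak{sl}_2(\mathbb{K})\oplus\mathbb{K}^3$ (direct sum with the $3$-dimensional abelian Lie algebra), where the summand $\mathfrak{sl}_2(\mathbb{K})$ is the span of $E_1=[A_0,A_1]$, $E_2=[A_0,[A_0,A_1]]$, $E_3=[A_1,[A_0,A_1]]$, and the summand $\mathbb{K}^3$ is the span of $Y$, $Z_0=-4\alpha A_0+[A_0,[A_0,A_1]]$, $Z_1=4\alpha A_1+[A_1,[A_0,A_1]]$.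 (2) If $\alpha=0$, then $\mathfrak{h}$ is nilpotent and $\dim\mathfrak{h}\le6$.
   Context: $\mathbb{K}$ is $\mathbb{C}$ or $\mathbb{R}$; Lie algebras are over $\mathbb{K}$. For an evolution equation $u_t=F(u_0,\dots,u_5)$ (with $u_k=\partial^ku/\partial x^k$, $F$ independent of $x,t$) and a point $a$ with coordinates $u_k=a_k$, the Wahlquist–Estabrook prolongation algebra is the Lie algebra with generators $\mathcal{A}_i$ ($i\ge0$) and $\mathcal{B}_{j_0\dots j_4}$ ($j_0,\dots,j_4\ge0$), subject to the relations obtained by requiring that all coefficients vanish in the formal power series identity $\sum_{k=0}^4u_{k+1}\frac{\partial\mathcal{B}}{\partial u_k}-F\,\frac{\partial\mathcal{A}}{\partial u_0}+[\mathcal{A},\mathcal{B}]=0$, where $\mathcal{A}=\sum_i(u_0-a_0)^i\mathcal{A}_i$, $\mathcal{B}=\sum\prod_{r=0}^4(u_r-a_r)^{j_r}\mathcal{B}_{j_0\dots j_4}$, polynomials in the $u_k$ are expanded in powers of $u_k-a_k$, and brackets are computed coefficientwise. *)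

(* Defs.v *)
From HB Require Import structures.
From mathcomp Require Import all_boot all_order all_algebra.
From mathcomp Require Import reals.
From mathcomp Require Import complex.
Set Implicit Arguments. Unset Strict Implicit. Unset Printing Implicit Defensive.
Import Order.TTheory GRing.Theory Num.Theory.
Local Open Scope ring_scope.

Definition KK (R : realType) (b : bool) : fieldType :=
  if b then (R[i] : fieldType) else (R : fieldType).

HB.mixin Record LmodIsLie (K : pzRingType) V of GRing.Lmodule K V := {
  lie : V -> V -> V;
  lieDl : forall (a : K) (x y z : V), lie (a *: x + y) z = a *: lie x z + lie y z;
  lieDr : forall (a : K) (x y z : V), lie x (a *: y + z) = a *: lie x y + lie x z;
  lie_alt : forall x : V, lie x x = 0;
  lie_jacobi : forall x y z : V,
    lie x (lie y z) + lie y (lie z x) + lie z (lie x y) = 0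
}.

#[short(type="lieAlgType")]
HB.structure Definition LieAlgebra (K : pzRingType) :=
  { V of LmodIsLie K V & GRing.Lmodule K V }.

Section LieDefs.
Variable K : fieldType.

Definition lie_hom (L M : lieAlgType K) (f : L -> M) :=
  (forall (a : K) (x y : L), f (a *: x + y) = a *: f x + f y) /\
  (forall x y : L, f (lie x y) = lie (f x) (f y)).

Definition lie_isomorphic (L M : lieAlgType K) :=
  exists f : L -> M, lie_hom f /\ bijective f.

(* Presentation by generators and relations, via the universal property:
   (L, g) is the Lie algebra generated by the family g : X -> L subject
   to the relations Rel (a predicate on families in arbitrary Lie
   algebras), i.e. g satisfies Rel and every family f : X -> M
   satisfying Rel extends uniquely along g to a Lie homomorphism. *)
Definition presents (X : Type)
  (Rel : forall M : lieAlgType K, (X -> M) -> Prop)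
  (L : lieAlgType K) (g : X -> L) :=
  Rel L g /\
  forall (M : lieAlgType K) (f : X -> M), Rel M f ->
    exists phi : L -> M,
      [/\ lie_hom phi, (forall x, phi (g x) = f x) &
          forall psi : L -> M, lie_hom psi -> (forall x, psi (g x) = f x) ->
            forall y, psi y = phi y].

Definition in_span (V : lmodType K) (s : seq V) (v : V) :=
  exists c : 'I_(size s) -> K, v = \sum_(i < size s) c i *: s`_i.

Definition lin_indep (V : lmodType K) (s : seq V) :=
  forall c : 'I_(size s) -> K, \sum_(i < size s) c i *: s`_i = 0 ->
    forall i, c i = 0.

Definition dim_le (V : lmodType K) (n : nat) :=
  exists s : seq V, (size s <= n)%N /\ forall v, in_span s v.

Inductive lcs (L : lieAlgType K) : nat -> L -> Prop :=
| lcs_all x : lcs 0 x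
| lcs_br n x y : lcs n y -> lcs n.+1 (lie x y)
| lcs_0 n : lcs n.+1 0
| lcs_D n x y : lcs n.+1 x -> lcs n.+1 y -> lcs n.+1 (x + y)
| lcs_Z n (c : K) x : lcs n.+1 x -> lcs n.+1 (c *: x).

Definition nilpotent (L : lieAlgType K) :=
  exists n, forall x : L, lcs n x -> x = 0.

(* sl_2(K) = traceless 2x2 matrices with the commutator bracket.
   [sl2_plus_K3 L S T]: L is the (Lie algebra) direct sum
   sl_2(K) (+) K^3 (K^3 abelian), the summand sl_2(K) being span S and
   the summand K^3 being span T; i.e. there is a Lie algebra isomorphism
   (X, v) |-> psi X + chi v from sl_2(K) x K^3 onto L with
   psi(sl_2(K)) = span S and chi(K^3) = span T. *)
Definition sl2_plus_K3 (L : lieAlgType K) (S T : seq L) :=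
  exists (psi : 'M[K]_2 -> L) (chi : 'rV[K]_3 -> L),
  [/\ (forall (a : K) X Y, psi (a *: X + Y) = a *: psi X + psi Y),
      (forall (a : K) v w, chi (a *: v + w) = a *: chi v + chi w),
      (forall X X' v v', \tr X = 0 -> \tr X' = 0 ->
        lie (psi X + chi v) (psi X' + chi v') = psi (X *m X' - X' *m X)),
      (forall X v, \tr X = 0 -> psi X + chi v = 0 -> X = 0 /\ v = 0) &
      [/\ (forall y : L, exists X v, \tr X = 0 /\ y = psi X + chi v),
          (forall y : L, in_span S y <-> exists X, \tr X = 0 /\ y = psi X) &
          (forall y : L, in_span T y <-> exists v, y = chi v)]].

Definition h_rel (alpha beta : K) (M : lieAlgType K) (f : 'I_3 -> M) : Prop :=
  let A0 := f (inord 0) in let A1 := f (inord 1) in let Y := f (inord 2) in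
  let c01 := lie A0 A1 in
  [/\ lie A1 (lie A1 c01) = 0,
      (4%:R * alpha) *: c01 + lie A0 (lie A1 c01) = 0,
      lie A1 (lie A1 (lie A0 (lie A0 c01))) = 0,
      lie A1 (lie A0 (lie A0 (lie A0 c01))) - beta *: lie A0 (lie A0 c01)
        + (2%:R)^-1 *: lie A0 (lie A1 (lie A0 (lie A0 c01))) = 0 &
      lie A1 Y + lie A0 (lie A0 (lie A0 (lie A0 c01))) = 0 /\
      lie A0 Y = 0].

(* Formal power series in v_k = u_k - a_k (k = 0..5) with coefficients *)
(* in M: functions from multi-indices 'I_6 -> nat to M.                *)
Definition mindex := 'I_6 -> nat.

Definition mi_up (m : mindex) (k : 'I_6) : mindex :=
  fun j => if j == k then (m j).+1 else m j.
Definition mi_down (m : mindex) (k : 'I_6) : mindex :=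
  fun j => if j == k then (m j).-1 else m j.

Section Series.
Variable M : lmodType K.
Definition pser := mindex -> M.

Definition ps_deriv (k : 'I_6) (S : pser) : pser :=
  fun m => (m k).+1%:R *: S (mi_up m k).

(* multiplication by u_k = a_k + v_k *)
Definition ps_mulu (a : 'I_6 -> K) (k : 'I_6) (S : pser) : pser :=
  fun m => a k *: S m + (if (0 < m k)%N then S (mi_down m k) else 0).
End Series.

Definition ps_lie (M : lieAlgType K) (S T : pser M) : pser M :=
  fun m => \sum_(p : {ffun 'I_6 -> 'I_(\sum_(k < 6) m k).+1} |
                  [forall k, (p k <= m k)%N])
             lie (S (fun k => (p k : nat))) (T (fun k => m k - p k)%N).

Definition uk (k : nat) : 'I_6 := inord k.

(* Generators: A_i (inl i) and B_{j0...j4} (inr j). *)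
Definition WEgen := (nat + {ffun 'I_5 -> nat})%type.

(* A = sum_i (u0-a0)^i A_i *)
Definition A_ser (M : lmodType K) (f : WEgen -> M) : pser M :=
  fun m => if [forall k : 'I_6, (k != uk 0) ==> (m k == 0%N)]
           then f (inl (m (uk 0))) else 0.

(* B = sum_j prod_{r<5} (u_r-a_r)^{j_r} B_j  *)
Definition B_ser (M : lmodType K) (f : WEgen -> M) : pser M :=
  fun m => if m (uk 5) == 0%N
           then f (inr [ffun r : 'I_5 => m (widen_ord (leqnSn 5) r)]) else 0.

Definition ps_mulF (alpha beta : K) (a : 'I_6 -> K) (M : lmodType K)
  (S : pser M) : pser M :=
  fun m =>
    ps_mulu a (uk 5) S m
    + (4%:R * alpha - 6%:R * beta) *: ps_mulu a (uk 1) (ps_mulu a (uk 2) S) m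
    + (8%:R * alpha - 2%:R * beta) *: ps_mulu a (uk 0) (ps_mulu a (uk 3) S) m
    - (20%:R * alpha * beta) *:
        ps_mulu a (uk 0) (ps_mulu a (uk 0) (ps_mulu a (uk 1) S)) m.

(* The relations: all coefficients of
   sum_{k=0}^4 u_{k+1} dB/du_k - F dA/du_0 + [A, B] vanish. *)
Definition WE_rel (alpha beta : K) (a : 'I_6 -> K)
  (M : lieAlgType K) (f : WEgen -> M) : Prop :=
  forall m : mindex,
    \sum_(k < 5) ps_mulu a (uk k.+1) (ps_deriv (uk k) (B_ser f)) m
    - ps_mulF alpha beta a (ps_deriv (uk 0) (A_ser f)) m
    + ps_lie (A_ser f) (B_ser f) m = 0.

End LieDefs.

(* Main.v *)
(* Applying partial derivatives to the defining identity of the prolongation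
   algebra determines all partial derivatives of B in terms of A; their
   compatibility forces A to be affine in u_0 (this uses 6 alpha + beta <> 0).
   Hence A = A0 + u_0 A1, B is an explicit polynomial in the u_k with coefficients
   in the subalgebra generated by A0, A1 and an integration constant Y, and the
   identity reduces to the relations of h. So both presentations have naturally
   the same solutions in every Lie algebra.

   In h the element E = [A0, [A0, [A0, A1]]] is an eigenvector of ad [A0, A1].
   The derivation ad Y applied to the relation [A1, [A1, [A0, A1]]] = 0 yields
   (alpha + beta) (6 alpha + beta) (16 alpha + beta) E = 0. Once E = 0, the
   elements A0, A1, [A0, A1], [A0, [A0, A1]], [A1, [A0, A1]], Y span h with an
   explicit multiplication table, which defines a Lie algebra on K^6. *)
Require Import Defs.
From HB Require Import structures.
From mathcomp Require Import all_boot all_order all_algebra.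
From mathcomp Require Import reals complex.
From mathcomp Require Import boolp functions.
From mathcomp Require Import ring.
Import Order.TTheory GRing.Theory Num.Theory.
Local Open Scope ring_scope.
Set Implicit Arguments. Unset Strict Implicit. Unset Printing Implicit Defensive.

(** * Linear combinations *)

Section LinearCombinations.
Variable K : fieldType.

(** Syntax for proof by reflection: an identity between combinations of vectors reduces to one
    scalar identity per atom, which [ring] or [field] can decide. *)
Inductive lexpr : Type :=
| LAtom of nat | LZero | LAdd of lexpr & lexpr | LOpp of lexpr
| LScale of K & lexpr.

(* [None] stands for the coefficient 0, which keeps the coefficients of sparse
   combinations small. *)
Fixpoint lcoef (e : lexpr) (n : nat) : option K :=
  match e with
  | LAtom i => if eqn i n then Some 1 else None
  | LZero => None
  | LAdd e1 e2 =>
      match lcoef e1 n, lcoef e2 n with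
      | Some a, Some b => Some (a + b)
      | Some a, None => Some a
      | None, b => b
      end
  | LOpp e1 => if lcoef e1 n is Some a then Some (- a) else None
  | LScale c e1 => if lcoef e1 n is Some a then Some (c * a) else None
  end.

Definition lcoef0 e n : K := if lcoef e n is Some a then a else 0.

Variable V : lmodType K.

Fixpoint leval (env : seq V) (e : lexpr) : V :=
  match e with
  | LAtom i => env`_i
  | LZero => 0
  | LAdd e1 e2 => leval env e1 + leval env e2
  | LOpp e1 => - leval env e1
  | LScale c e1 => c *: leval env e1
  end.

Lemma leval_coef env e :
  leval env e = \sum_(i < size env) lcoef0 e i *: env`_i.
Proof.
rewrite /lcoef0; elim: e => [n||e1 IH1 e2 IH2|e IH|c e IH] /=.
- have [lt_n|le_n] := ltnP n (size env).
    rewrite (bigD1 (Ordinal lt_n)) //= eqnE eqxx scale1r big1 ?addr0 // => i.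
    by rewrite -val_eqE /= eq_sym => /negPf ->; rewrite scale0r.
  rewrite nth_default // big1 // => i _.
  by rewrite eqnE gtn_eqF ?scale0r // (leq_trans (ltn_ord i)).
- by rewrite big1 // => i _; rewrite scale0r.
- rewrite IH1 IH2 -big_split /=; apply: eq_bigr => i _.
  by case: (lcoef e1 i) (lcoef e2 i) => [a|] [b|];
    rewrite ?scale0r ?add0r ?addr0 ?scalerDl.
- rewrite IH -sumrN; apply: eq_bigr => i _.
  by case: (lcoef e i) => [a|]; rewrite ?scale0r ?oppr0 ?scaleNr.
- rewrite IH scaler_sumr; apply: eq_bigr => i _.
  by case: (lcoef e i) => [a|]; rewrite ?scale0r ?scaler0 ?scalerA.
Qed.

(** A recursive conjunction, so that computation unfolds it into a finite list of scalar goals. *)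
Fixpoint same_coefs (e1 e2 : lexpr) (n : nat) : Prop :=
  if n is n'.+1 then lcoef0 e1 n' = lcoef0 e2 n' /\ same_coefs e1 e2 n'
  else True.

Lemma leval_eq env e1 e2 :
  same_coefs e1 e2 (size env) -> leval env e1 = leval env e2.
Proof.
rewrite !leval_coef => He; apply: eq_bigr => -[i lt_i] _ /=; congr (_ *: _).
elim: (size env) lt_i He => // n IHn; rewrite ltnS leq_eqVlt => /orP[/eqP->|].
  by case.
by move=> lt_in [_ /IHn]; apply.
Qed.
End LinearCombinations.

(* Atoms are compared up to conversion because rewriting may produce distinct
   coherence paths between the algebraic structures. *)
Ltac same_atom x y :=
  match constr:(Set) with
  | _ => let _ := match goal with _ => unify x y end in constr:(true)
  | _ => constr:(false)
  end.

Ltac atom_in x env :=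
  lazymatch env with
  | nil => constr:(false)
  | cons ?y ?env' =>
      let b := same_atom x y in
      lazymatch b with true => constr:(true) | _ => atom_in x env' end
  end.

Ltac collect_atoms V e env :=
  lazymatch e with
  | GRing.add ?x ?y => let env' := collect_atoms V x env in collect_atoms V y env'
  | GRing.opp ?x => collect_atoms V x env
  | GRing.scale _ ?x => collect_atoms V x env
  | GRing.zero => env
  | _ => let b := atom_in e env in
         lazymatch b with
         | true => env
         | false => constr:(@cons V e env)
         end
  end.

Ltac atom_index x env :=
  lazymatch env with
  | cons ?y ?env' =>
      let b := same_atom x y in
      lazymatch b with
      | true => constr:(O)
      | _ => let n := atom_index x env' in constr:(S n)
      end
  end.

Ltac reify_lexpr K e env :=
  lazymatch e with
  | GRing.add ?x ?y =>
      let a := reify_lexpr K x env in let b := reify_lexpr K y env in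
      constr:(@LAdd K a b)
  | GRing.opp ?x => let a := reify_lexpr K x env in constr:(@LOpp K a)
  | GRing.scale ?c ?x => let a := reify_lexpr K x env in constr:(@LScale K c a)
  | GRing.zero => constr:(@LZero K)
  | _ => let n := atom_index e env in constr:(@LAtom K n)
  end.

Tactic Notation "lmod_eq" constr(K) constr(V) "by" tactic3(tac) :=
  lazymatch goal with
  | |- ?l = ?r =>
      let env0 := collect_atoms V l (@nil V) in
      let env := collect_atoms V r env0 in
      let a := reify_lexpr K l env in
      let b := reify_lexpr K r env in
      refine (@leval_eq K V env a b _);
      cbn [same_coefs lcoef0 lcoef size eqn];
      do ![split]; tac
  end.

Lemma scaler_cancel (K : fieldType) (V : lmodType K) (x : K) (v : V) :
  x != 0 -> x *: v = 0 -> v = 0.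
Proof. by move=> /negPf x0 /eqP; rewrite scaler_eq0 x0 => /eqP. Qed.

(** * Lie algebras *)

Section LieTheory.
Variables (K : fieldType) (L : lieAlgType K).
Implicit Types (x y z : L) (c : K).

Lemma lie0x y : lie 0 y = 0.
Proof. by have := lieDl (-1) 0 0 y; rewrite scaler0 addr0 scaleN1r addNr. Qed.
Lemma liex0 x : lie x 0 = 0.
Proof. by have := lieDr (-1) x 0 0; rewrite scaler0 addr0 scaleN1r addNr. Qed.
Lemma lieZx c x y : lie (c *: x) y = c *: lie x y.
Proof. by have := lieDl c x 0 y; rewrite !addr0 lie0x addr0. Qed.
Lemma liexZ c x y : lie x (c *: y) = c *: lie x y.
Proof. by have := lieDr c x y 0; rewrite !addr0 liex0 addr0. Qed.
Lemma lieDx x y z : lie (x + y) z = lie x z + lie y z.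
Proof. by have := lieDl 1 x y z; rewrite !scale1r. Qed.
Lemma liexD x y z : lie x (y + z) = lie x y + lie x z.
Proof. by have := lieDr 1 x y z; rewrite !scale1r. Qed.
Lemma lieNx x y : lie (- x) y = - lie x y.
Proof. by rewrite -scaleN1r lieZx scaleN1r. Qed.
Lemma liexN x y : lie x (- y) = - lie x y.
Proof. by rewrite -scaleN1r liexZ scaleN1r. Qed.
Definition lieE := (lie0x, liex0, lieDx, liexD, lieNx, liexN, lieZx, liexZ).

Lemma lie_anti x y : lie x y = - lie y x.
Proof.
have := lie_alt (x + y); rewrite !lieE !lie_alt add0r addr0 => /eqP.
by rewrite addrC addr_eq0 => /eqP ->; rewrite opprK.
Qed.

Lemma lie_deriv x y z : lie x (lie y z) = lie (lie x y) z + lie y (lie x z).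
Proof.
have /eqP := lie_jacobi x y z.
rewrite -addrA addr_eq0 => /eqP ->; rewrite opprD addrC.
by rewrite (lie_anti z (lie _ _)) opprK (lie_anti z x) liexN opprK.
Qed.

Lemma lie_left x y z : lie (lie x y) z = lie x (lie y z) - lie y (lie x z).
Proof. by rewrite lie_deriv addrK. Qed.
End LieTheory.

(** * The structure of h *)

Section Vanishing.
Variables (K : fieldType) (char0 : forall n : nat, n.+1%:R != 0 :> K).
Variables (alpha beta : K) (L : lieAlgType K).
Hypotheses (H1 : alpha + beta != 0) (H6 : 6%:R * alpha + beta != 0)
  (H16 : 16%:R * alpha + beta != 0).
(** Iterated brackets are variables tied by equations, so that rewriting treats them as atoms. *)
Variables A0 A1 Y c E2 E3 E4 E5 E6 : L.
Hypotheses (cE : lie A0 A1 = c) (E2E : lie A0 c = E2) (E3E : lie A1 c = E3)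
  (E4E : lie A0 E2 = E4) (E5E : lie A0 E4 = E5) (E6E : lie A0 E5 = E6).
Hypotheses (R1 : lie A1 E3 = 0) (R2 : (4%:R * alpha) *: c + lie A0 E3 = 0)
  (R3 : lie A1 (lie A1 E4) = 0)
  (R4 : lie A1 E5 - beta *: E4 + 2%:R^-1 *: lie A0 (lie A1 E4) = 0)
  (R5 : lie A1 Y + E6 = 0) (R6 : lie A0 Y = 0).

Lemma lie_A1_A0 z : lie A1 (lie A0 z) = lie A0 (lie A1 z) - lie c z.
Proof. by rewrite lie_deriv (lie_anti A1 A0) cE lieNx addrC. Qed.

Lemma ad0_ad1_bracket : lie A0 E3 = - (4%:R * alpha) *: c.
Proof. by move/eqP: R2; rewrite addrC addr_eq0 scaleNr => /eqP. Qed.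

Lemma ad1_ad0_bracket : lie A1 E2 = - (4%:R * alpha) *: c.
Proof. by rewrite -E2E lie_A1_A0 E3E ad0_ad1_bracket lie_alt subr0. Qed.

(** This is the eigenvalue of ad [c] on [E4], see [cE4] below. *)
Let lam : K := - (2%:R / 5%:R) * (6%:R * alpha + beta).
Let P := lie A1 E4.

(* With P = [A1, E4] and Q = [E2, E4], the derivation ad Y applied to R1 expresses
   [P, E4] as a combination of E5 and Q. Bracketing with A1 kills [P, E4] and
   leaves a multiple of E4 whose coefficient is, up to a nonzero rational, the
   product of the three nonvanishing quantities. *)
Lemma triple_bracket_eq0 : E4 = 0.
Proof.
have n2 : 2%:R != 0 :> K by exact: char0.
have n5 : 5%:R != 0 :> K by exact: char0.
have cE2 : lie c E2 = - P - (4%:R * alpha) *: E2.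
  rewrite /P -E4E lie_A1_A0 ad1_ad0_bracket !lieE E2E.
  lmod_eq K L by ring.
have A1P : lie A1 P = 0 by [].
have A0Pc : lie A0 P = - lie c E4 - (4%:R * alpha) *: E4.
  have := lie_deriv A0 c E2; rewrite E2E E4E lie_alt add0r => <-.
  rewrite cE2 !lieE E4E; lmod_eq K L by ring.
(* Expanding [lie A1 E5] and [lie A0 P] turns [R4] into a linear relation between [lie c E4] and
   [E4]; the coefficient of [lie c E4] is -5/2. *)
have cE4 : lie c E4 = lam *: E4.
  apply/eqP; rewrite -subr_eq0; apply/eqP.
  apply: (@scaler_cancel _ _ (- (5%:R / 2%:R))).
    by rewrite oppr_eq0 mulf_neq0 ?invr_eq0.
  rewrite -{}R4 -E5E lie_A1_A0 -/P A0Pc /lam.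
  by lmod_eq K L by field; rewrite ?n2 ?n5.
have A0P : lie A0 P = - (lam + 4%:R * alpha) *: E4.
  by rewrite A0Pc cE4; lmod_eq K L by ring.
have cP : lie c P = (lam + 4%:R * alpha) *: P.
  rewrite -cE lie_left A1P A0P !lieE -/P; lmod_eq K L by ring.
have A1E5 : lie A1 E5 = - (2%:R * lam + 4%:R * alpha) *: E4.
  by rewrite -E5E lie_A1_A0 -/P A0P cE4; lmod_eq K L by ring.
have cA0 z : lie c (lie A0 z) = lie A0 (lie c z) - lie E2 z.
  by rewrite lie_deriv (lie_anti c A0) E2E lieNx addrC.
pose Q := lie E2 E4; pose Q1 := lie A0 Q.
have cE5 : lie c E5 = lam *: E5 - Q.
  by rewrite -E5E cA0 cE4 !lieE E5E.
have E2E5 : lie E2 E5 = Q1.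
  by rewrite /Q1 /Q lie_deriv E4E lie_alt add0r E5E.
have cE6 : lie c E6 = lam *: E6 - 2%:R *: Q1.
  rewrite -E6E cA0 cE5 !lieE E6E E2E5 -/Q1; lmod_eq K L by ring.
have A1E6 : lie A1 E6 = Q - (3%:R * lam + 4%:R * alpha) *: E5.
  rewrite -E6E lie_A1_A0 A1E5 cE5 !lieE E5E; lmod_eq K L by ring.
have A1A0E6 : lie A1 (lie A0 E6) = 3%:R *: Q1 - (4%:R * lam + 4%:R * alpha) *: E6.
  rewrite lie_A1_A0 A1E6 cE6 !lieE E6E -/Q1; lmod_eq K L by ring.
(* ad [Y] kills [A0] and sends [A1] to [E6], which determines it on all iterated brackets of the
   two. *)
have YA0 : lie Y A0 = 0 by rewrite lie_anti R6 oppr0.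
have YA1 : lie Y A1 = E6.
  by rewrite lie_anti; move/eqP: R5; rewrite addr_eq0 => /eqP ->; rewrite opprK.
have Yc : lie Y c = lie A0 E6 by rewrite -cE lie_deriv YA0 YA1 !lieE add0r.
have YE3 : lie Y E3 = 5%:R *: Q1 - (5%:R * lam + 4%:R * alpha) *: E6.
  rewrite -E3E lie_deriv YA1 Yc A1A0E6 lie_anti cE6; lmod_eq K L by ring.
have E3z z : lie E3 z = lie A1 (lie c z) - lie c (lie A1 z).
  by rewrite -E3E lie_left.
have E3A0 z : lie E3 (lie A0 z) = lie A0 (lie E3 z) + (4%:R * alpha) *: lie c z.
  by rewrite lie_deriv (lie_anti E3) ad0_ad1_bracket !lieE scaleNr opprK addrC.
have E3E4 : lie E3 E4 = - (4%:R * alpha) *: P.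
  rewrite E3z cE4 -/P cP !lieE -/P; lmod_eq K L by ring.
have E3E5 : lie E3 E5 = 4%:R * alpha * (2%:R * lam + 4%:R * alpha) *: E4.
  rewrite -E5E E3A0 E3E4 cE4 !lieE A0P; lmod_eq K L by ring.
have E3E6 : lie E3 E6 = 4%:R * alpha * (3%:R * lam + 4%:R * alpha) *: E5
    - (4%:R * alpha) *: Q.
  rewrite -E6E E3A0 E3E5 cE5 !lieE E5E; lmod_eq K L by ring.
have E2P : lie E2 P = - (4%:R * alpha * (lam + 4%:R * alpha)) *: E4.
  rewrite -E2E lie_left A0P cP !lieE A0P cE4; lmod_eq K L by ring.
have A1Q : lie A1 Q = - (4%:R * alpha * (2%:R * lam + 4%:R * alpha)) *: E4.
  rewrite lie_deriv ad1_ad0_bracket -/P E2P !lieE cE4; lmod_eq K L by ring.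
have cQ : lie c Q = - lie P E4 + (lam - 4%:R * alpha) *: Q.
  rewrite lie_deriv cE2 cE4 !lieE -/Q; lmod_eq K L by ring.
have A1Q1 : lie A1 Q1 = - (4%:R * alpha * (2%:R * lam + 4%:R * alpha)) *: E5
    + lie P E4 - (lam - 4%:R * alpha) *: Q.
  rewrite lie_A1_A0 A1Q cQ !lieE E5E; lmod_eq K L by ring.
have A1PE4 : lie A1 (lie P E4) = 0 by rewrite lie_deriv A1P lie_alt lie0x addr0.
have := lie_deriv Y A1 E3; rewrite R1 YA1 YE3 (lie_anti E6) E3E6 !lieE A1Q1 A1E6.
move/(congr1 (lie A1)); rewrite !lieE A1PE4 A1Q A1E5 => /esym Hfin.
(* Up to nonzero rationals the three factors are 6 alpha + beta, 16 alpha + beta and alpha + beta,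
   in this order. *)
apply: (@scaler_cancel _ _ (- (15%:R * lam * (lam - 4%:R * alpha) * (2%:R * lam + 4%:R * alpha)))).
  have -> : lam - 4%:R * alpha = - (2%:R / 5%:R) * (16%:R * alpha + beta).
    by rewrite /lam; field; rewrite n5.
  have -> : 2%:R * lam + 4%:R * alpha = - (4%:R / 5%:R) * (alpha + beta).
    by rewrite /lam; field; rewrite n5.
  by rewrite /lam !(oppr_eq0, mulf_eq0, invr_eq0) !negb_or H1 H6 H16 !char0.
rewrite -[RHS]Hfin; lmod_eq K L by ring.
Qed.
End Vanishing.

(** * The six-dimensional model of h *)

(** The phantom parameter [alpha] lets the type carry a Lie structure that depends on it. *)
Definition hmodel (K : fieldType) (alpha : K) : Type :=
  (K^o * K^o * K^o * K^o * K^o * K^o)%type.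

Section Model.
Variables (K : fieldType) (alpha : K).
Local Notation H := (hmodel alpha).

HB.instance Definition _ := GRing.Lmodule.on H.

(* [hvec x0 x1 xc x2 x3 y] stands for
   x0 A0 + x1 A1 + xc [A0, A1] + x2 [A0, [A0, A1]] + x3 [A1, [A0, A1]] + y Y. *)
Fact hvec_key : unit. Proof. by []. Qed.
Definition hvec : K -> K -> K -> K -> K -> K -> H :=
  locked_with hvec_key (fun x0 x1 xc x2 x3 y => (x0, x1, xc, x2, x3, y)).
Canonical hvec_unlockable := [unlockable of hvec].

Lemma hvecP (x : H) : exists x0 x1 xc x2 x3 y, x = hvec x0 x1 xc x2 x3 y.
Proof.
case: x => [[[[[x0 x1] xc] x2] x3] y]; exists x0, x1, xc, x2, x3, y.
by rewrite unlock.
Qed.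

Lemma hvecD x0 x1 xc x2 x3 x y0 y1 yc y2 y3 y :
  hvec x0 x1 xc x2 x3 x + hvec y0 y1 yc y2 y3 y =
  hvec (x0 + y0) (x1 + y1) (xc + yc) (x2 + y2) (x3 + y3) (x + y).
Proof. by rewrite unlock. Qed.

Lemma hvecZ a x0 x1 xc x2 x3 x :
  a *: hvec x0 x1 xc x2 x3 x =
  hvec (a * x0) (a * x1) (a * xc) (a * x2) (a * x3) (a * x).
Proof. by rewrite unlock. Qed.

Lemma hvec0 : 0 = hvec 0 0 0 0 0 0.
Proof. by rewrite unlock. Qed.

(* The elements [A0, [A0, A1]] - 4 alpha A0 and [A1, [A0, A1]] + 4 alpha A1 are
   central, so that the bracket only depends on three linear forms. *)
Definition hlow (x : H) : K := x.1.1.1.1.1 + 4%:R * alpha * x.1.1.2.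
Definition hup (x : H) : K := x.1.1.1.1.2 - 4%:R * alpha * x.1.2.
Definition hdiag (x : H) : K := x.1.1.1.2.

Definition hlie : H -> H -> H :=
  locked_with hvec_key (fun x y =>
    hvec 0 0 (hlow x * hup y - hup x * hlow y)
      (hlow x * hdiag y - hdiag x * hlow y)
      (hup x * hdiag y - hdiag x * hup y) 0).
Canonical hlie_unlockable := [unlockable of hlie].

Lemma hlieE x0 x1 xc x2 x3 x y0 y1 yc y2 y3 y :
  hlie (hvec x0 x1 xc x2 x3 x) (hvec y0 y1 yc y2 y3 y) =
  hvec 0 0
    ((x0 + 4%:R * alpha * x2) * (y1 - 4%:R * alpha * y3)
     - (x1 - 4%:R * alpha * x3) * (y0 + 4%:R * alpha * y2))
    ((x0 + 4%:R * alpha * x2) * yc - xc * (y0 + 4%:R * alpha * y2))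
    ((x1 - 4%:R * alpha * x3) * yc - xc * (y1 - 4%:R * alpha * y3)) 0.
Proof. by rewrite !unlock. Qed.

Fact hlieDl (a : K) (x y z : H) :
  hlie (a *: x + y) z = a *: hlie x z + hlie y z.
Proof.
have [x0 [x1 [xc [x2 [x3 [x4 ->]]]]]] := hvecP x.
have [y0 [y1 [yc [y2 [y3 [y4 ->]]]]]] := hvecP y.
have [z0 [z1 [zc [z2 [z3 [z4 ->]]]]]] := hvecP z.
by rewrite !(hvecZ, hvecD, hlieE); congr hvec; ring.
Qed.

Fact hlie_alt (x : H) : hlie x x = 0.
Proof.
have [x0 [x1 [xc [x2 [x3 [x4 ->]]]]]] := hvecP x.
by rewrite hlieE hvec0; congr hvec; ring.
Qed.

Fact hlieDr (a : K) (x y z : H) :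
  hlie x (a *: y + z) = a *: hlie x y + hlie x z.
Proof.
have [x0 [x1 [xc [x2 [x3 [x4 ->]]]]]] := hvecP x.
have [y0 [y1 [yc [y2 [y3 [y4 ->]]]]]] := hvecP y.
have [z0 [z1 [zc [z2 [z3 [z4 ->]]]]]] := hvecP z.
by rewrite !(hvecZ, hvecD, hlieE); congr hvec; ring.
Qed.

Fact hlie_jacobi (x y z : H) :
  hlie x (hlie y z) + hlie y (hlie z x) + hlie z (hlie x y) = 0.
Proof.
have [x0 [x1 [xc [x2 [x3 [x4 ->]]]]]] := hvecP x.
have [y0 [y1 [yc [y2 [y3 [y4 ->]]]]]] := hvecP y.
have [z0 [z1 [zc [z2 [z3 [z4 ->]]]]]] := hvecP z.
by rewrite !hlieE !hvecD hvec0; congr hvec; ring.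
Qed.

HB.instance Definition _ :=
  LmodIsLie.Build K H hlieDl hlieDr hlie_alt hlie_jacobi.

Lemma lie_hvec x0 x1 xc x2 x3 x y0 y1 yc y2 y3 y :
  lie (hvec x0 x1 xc x2 x3 x) (hvec y0 y1 yc y2 y3 y) =
  hvec 0 0
    ((x0 + 4%:R * alpha * x2) * (y1 - 4%:R * alpha * y3)
     - (x1 - 4%:R * alpha * x3) * (y0 + 4%:R * alpha * y2))
    ((x0 + 4%:R * alpha * x2) * yc - xc * (y0 + 4%:R * alpha * y2))
    ((x1 - 4%:R * alpha * x3) * yc - xc * (y1 - 4%:R * alpha * y3)) 0.
Proof. exact: hlieE. Qed.

Lemma hvec_inj x0 x1 xc x2 x3 x y0 y1 yc y2 y3 y :
  hvec x0 x1 xc x2 x3 x = hvec y0 y1 yc y2 y3 y ->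
  [/\ x0 = y0, x1 = y1 & xc = yc] /\ [/\ x2 = y2, x3 = y3 & x = y].
Proof. by rewrite unlock => -[-> -> -> -> -> ->]. Qed.
End Model.

Section LieHomTheory.
Variables (K : fieldType) (L M : lieAlgType K) (f : L -> M) (Hf : lie_hom f).

Lemma lie_homD x y : f (x + y) = f x + f y.
Proof. by have := Hf.1 1 x y; rewrite !scale1r. Qed.
Lemma lie_hom0 : f 0 = 0.
Proof. by have := Hf.1 (-1) 0 0; rewrite scaler0 addr0 scaleN1r addNr. Qed.
Lemma lie_homZ a x : f (a *: x) = a *: f x.
Proof. by have := Hf.1 a x 0; rewrite !addr0 lie_hom0 addr0. Qed.
Lemma lie_homN x : f (- x) = - f x.
Proof. by rewrite -scaleN1r lie_homZ scaleN1r. Qed.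
Lemma lie_homL x y : f (lie x y) = lie (f x) (f y).
Proof. exact: Hf.2. Qed.
Definition lie_homE := (lie_hom0, lie_homD, lie_homN, lie_homZ, lie_homL).
End LieHomTheory.

Lemma lie_hom_id (K : fieldType) (L : lieAlgType K) : lie_hom (@id L).
Proof. by []. Qed.

Lemma lie_hom_comp (K : fieldType) (L M N : lieAlgType K)
  (f : L -> M) (g : M -> N) : lie_hom f -> lie_hom g -> lie_hom (g \o f).
Proof. by move=> [fD fL] [gD gL]; split=> * /=; rewrite ?(fD, fL) ?(gD, gL). Qed.

(** Both [phi] and the identity extend [g], and the universal property with target [L] allows one
    extension only. This is how composites are recognised as identities. *)
Lemma presents_id (K : fieldType) (X : Type)
    (Rel : forall M : lieAlgType K, (X -> M) -> Prop) (L : lieAlgType K)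
    (g : X -> L) (phi : L -> L) :
  presents Rel g -> lie_hom phi -> (forall x, phi (g x) = g x) -> phi =1 id.
Proof.
move=> [Rg univ] Hphi phig; have [xi [_ _ uniq]] := univ L g Rg.
move=> y; rewrite (uniq phi Hphi phig y).
by rewrite -(uniq id (@lie_hom_id K L) (fun=> erefl) y).
Qed.

Section Structure.
Variables (K : fieldType) (char0 : forall n : nat, n.+1%:R != 0 :> K).
Variables (alpha beta : K).
Hypotheses (H1 : alpha + beta != 0) (H6 : 6%:R * alpha + beta != 0)
  (H16 : 16%:R * alpha + beta != 0).
Local Notation H := (hmodel alpha).

Definition hmodel_gen (i : 'I_3) : H :=
  match val i with
  | 0%N => hvec alpha 1 0 0 0 0 0
  | 1%N => hvec alpha 0 1 0 0 0 0
  | _ => hvec alpha 0 0 0 0 0 1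
  end.

Lemma hmodel_gen0 : hmodel_gen (inord 0) = hvec alpha 1 0 0 0 0 0.
Proof. by rewrite /hmodel_gen /= inordK. Qed.
Lemma hmodel_gen1 : hmodel_gen (inord 1) = hvec alpha 0 1 0 0 0 0.
Proof. by rewrite /hmodel_gen /= inordK. Qed.
Lemma hmodel_gen2 : hmodel_gen (inord 2) = hvec alpha 0 0 0 0 0 1.
Proof. by rewrite /hmodel_gen /= inordK. Qed.

Lemma hmodel_rel : h_rel alpha beta hmodel_gen.
Proof.
rewrite /h_rel hmodel_gen0 hmodel_gen1 hmodel_gen2 -!scaleNr.
by split; [| | | |split]; rewrite !lie_hvec ?hvecZ ?hvecD hvec0; congr hvec; ring.
Qed.

Section Embedding.
Variables (L : lieAlgType K) (A0 A1 Y : L).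
Local Notation c := (lie A0 A1).

Definition hembed (x : H) : L :=
  x.1.1.1.1.1 *: A0 + x.1.1.1.1.2 *: A1 + x.1.1.1.2 *: c
  + x.1.1.2 *: lie A0 c + x.1.2 *: lie A1 c + x.2 *: Y.

Lemma hembedE x0 x1 xc x2 x3 y : hembed (hvec alpha x0 x1 xc x2 x3 y) =
  x0 *: A0 + x1 *: A1 + xc *: c + x2 *: lie A0 c + x3 *: lie A1 c + y *: Y.
Proof. by rewrite unlock. Qed.

(** Once the triple bracket vanishes, all products of the six elements follow from the relations by
    the derivation rule, and they agree with the table [hlie]. In particular [lie A0 c] and
    [lie A1 c] are eigenvectors of ad [c] with eigenvalues -4 alpha and 4 alpha. *)
Lemma hembed_hom (f : 'I_3 -> L) : h_rel alpha beta f ->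
  f (inord 0) = A0 -> f (inord 1) = A1 -> f (inord 2) = Y -> lie_hom hembed.
Proof.
rewrite /h_rel => + f0 f1 f2; rewrite {}f0 {}f1 {}f2.
move=> [R1 R2 R3 R4 [R5 R6]].
have E4_0 : lie A0 (lie A0 c) = 0.
  by apply: (@triple_bracket_eq0 K char0 alpha beta L H1 H6 H16 A0 A1 Y) R5 R6.
have cE3 : lie A0 (lie A1 c) = - (4%:R * alpha) *: c.
  exact: ad0_ad1_bracket R2.
have cE2 : lie A1 (lie A0 c) = - (4%:R * alpha) *: c.
  exact: ad1_ad0_bracket R2.
have A1Y : lie A1 Y = 0 by move: R5; rewrite E4_0 !lieE addr0.
pose E2 := lie A0 c; pose E3 := lie A1 c; rewrite -/E2 -/E3 in R1 E4_0 cE3 cE2.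
have cz z : lie c z = lie A0 (lie A1 z) - lie A1 (lie A0 z) by exact: lie_left.
have E2z z : lie E2 z = lie A0 (lie c z) - lie c (lie A0 z) by exact: lie_left.
have E3z z : lie E3 z = lie A1 (lie c z) - lie c (lie A1 z) by exact: lie_left.
have cY : lie c Y = 0 by rewrite cz A1Y R6 !lieE subrr.
have E2Y : lie E2 Y = 0 by rewrite E2z cY R6 !lieE subrr.
have E3Y : lie E3 Y = 0 by rewrite E3z cY A1Y !lieE subrr.
have ccE2 : lie c E2 = - (4%:R * alpha) *: E2.
  by rewrite cz cE2 E4_0 !lieE subr0.
have ccE3 : lie c E3 = (4%:R * alpha) *: E3.
  by rewrite cz cE3 R1 !lieE -/E3; lmod_eq K L by ring.
have E2E3 : lie E2 E3 = - (16%:R * alpha ^+ 2) *: c.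
  by rewrite E2z ccE3 cE3 !lieE lie_alt cE3; lmod_eq K L by ring.
split=> [a x y|x y].
  rewrite /hembed /=; move: x y.
  case=> [[[[[x0 x1] xc] x2] x3] x4] [[[[[y0 y1] yc] y2] y3] y4] /=.
  by rewrite !scalerDl -!scalerA; lmod_eq K L by ring.
have [x0 [x1 [xc [x2 [x3 [x4 ->]]]]]] := hvecP x.
have [y0 [y1 [yc [y2 [y3 [y4 ->]]]]]] := hvecP y.
rewrite lie_hvec !hembedE -/E2 -/E3 !lieE.
rewrite !lie_alt (lie_anti A1 A0) (lie_anti c A0) (lie_anti E2 A0) (lie_anti E3 A0).
rewrite (lie_anti Y A0) (lie_anti c A1) (lie_anti E2 A1) (lie_anti E3 A1).
rewrite (lie_anti Y A1) (lie_anti E2 c) (lie_anti E3 c) (lie_anti Y c).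
rewrite (lie_anti E3 E2) (lie_anti Y E2) (lie_anti Y E3).
rewrite -/E2 -/E3 R6 A1Y cY E2Y E3Y cE2 cE3 E4_0 R1 ccE2 ccE3 E2E3.
by lmod_eq K L by ring.
Qed.
End Embedding.

(** The model satisfies the relations, which gives [phi]; the multiplication table gives [emb]. The
    composite on h fixes the generators, the one on the model is computed in coordinates. *)
Lemma hmodel_iso (h : lieAlgType K) (g : 'I_3 -> h) :
  presents (@h_rel K alpha beta) g ->
  let emb := hembed (g (inord 0)) (g (inord 1)) (g (inord 2)) in
  exists phi : h -> H, [/\ lie_hom phi, lie_hom emb, cancel phi emb & cancel emb phi].
Proof.
move=> Hh emb; have [Rg univ] := Hh.
have [phi [Hphi phig _]] := univ H hmodel_gen hmodel_rel.
have Hemb : lie_hom emb by apply: hembed_hom Rg _ _ _.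
exists phi; split=> // [x|x].
  apply: (presents_id Hh (lie_hom_comp Hphi Hemb)) => i /=; rewrite phig.
  have := inord_val i; rewrite /hmodel_gen.
  case: i => -[|[|[|//]]] lt_i /= <-; rewrite /emb hembedE;
    lmod_eq K h by ring.
have [x0 [x1 [xc [x2 [x3 [x4 ->]]]]]] := hvecP x.
rewrite /emb hembedE !(lie_homE Hphi) !phig hmodel_gen0 hmodel_gen1 hmodel_gen2.
rewrite !lie_hvec !hvecZ !hvecD; congr hvec; ring.
Qed.
End Structure.

(** * Spans of three vectors and traceless matrices of size two *)

Section Spans.
Variables (K : fieldType) (V : lmodType K).

Lemma in_span3 (u v w y : V) :
  in_span [:: u; v; w] y <-> exists a b c, y = a *: u + b *: v + c *: w.
Proof.
split=> [[c ->]|[a [b [c ->]]]].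
  by exists (c 0), (c (lift 0 0)), (c (lift 0 (lift 0 0)));
    rewrite !big_ord_recl big_ord0 addr0 addrA.
exists (fun i => [:: a; b; c]`_i).
by rewrite !big_ord_recl big_ord0 addr0 addrA.
Qed.
End Spans.

Lemma mulmx2E (K : fieldType) (X Y : 'M[K]_2) i j :
  (X *m Y) i j = X i 0 * Y 0 j + X i 1 * Y 1 j.
Proof.
rewrite mxE !big_ord_recl big_ord0 addr0.
by rewrite (_ : lift 0 0 = 1) //; apply: val_inj.
Qed.

Lemma commmx2E (K : fieldType) (X Y : 'M[K]_2) i j :
  (X *m Y - Y *m X) i j =
  X i 0 * Y 0 j + X i 1 * Y 1 j - (Y i 0 * X 0 j + Y i 1 * X 1 j).
Proof. by rewrite mxE [(- _ : 'M_2) _ _]mxE !mulmx2E. Qed.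

Lemma mxtrace2E (K : fieldType) (X : 'M[K]_2) : \tr X = X 0 0 + X 1 1.
Proof.
rewrite /mxtrace !big_ord_recl big_ord0 addr0.
by rewrite (_ : lift 0 0 = 1) //; apply: val_inj.
Qed.

Lemma tr0_diag (K : fieldType) (X : 'M[K]_2) : \tr X = 0 -> X 1 1 = - X 0 0.
Proof. by move=> /eqP; rewrite mxtrace2E addrC addr_eq0 => /eqP. Qed.

Lemma mx2P (K : fieldType) (X Y : 'M[K]_2) : X 0 0 = Y 0 0 -> X 0 1 = Y 0 1 ->
  X 1 0 = Y 1 0 -> X 1 1 = Y 1 1 -> X = Y.
Proof.
move=> e00 e01 e10 e11; apply/matrixP => i j.
have ord2 (k : 'I_2) : k = 0 \/ k = 1.
  by case: k => -[|[|//]] lt_k; [left|right]; apply: val_inj.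
by case: (ord2 i) => ->; case: (ord2 j) => ->.
Qed.

(** * The decomposition, dimension and nilpotency of h *)

Section Decomposition.
Variables (K : fieldType) (char0 : forall n : nat, n.+1%:R != 0 :> K).
Variables (alpha beta : K).
Hypotheses (H1 : alpha + beta != 0) (H6 : 6%:R * alpha + beta != 0)
  (H16 : 16%:R * alpha + beta != 0).
Variables (h : lieAlgType K) (g : 'I_3 -> h).
Hypothesis Hh : presents (@h_rel K alpha beta) g.
Local Notation A0 := (g (inord 0)).
Local Notation A1 := (g (inord 1)).
Local Notation Y := (g (inord 2)).
Local Notation emb := (hembed A0 A1 Y).
Local Notation hv := (hvec alpha).
Local Notation i0 := (ord0 : 'I_3).
Local Notation i1 := (Ordinal (isT : 1 < 3)%N).
Local Notation i2 := (Ordinal (isT : 2 < 3)%N).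

Lemma rV3P (v w : 'rV[K]_3) : v 0 i0 = w 0 i0 -> v 0 i1 = w 0 i1 ->
  v 0 i2 = w 0 i2 -> v = w.
Proof.
move=> e0 e1 e2; apply/rowP => -[[|[|[|//]]] lt_j].
- by rewrite (_ : Ordinal lt_j = i0) //; apply: val_inj.
- by rewrite (_ : Ordinal lt_j = i1) //; apply: val_inj.
- by rewrite (_ : Ordinal lt_j = i2) //; apply: val_inj.
Qed.

(* The factors make [A1, [A0, A1]] and [A0, [A0, A1]] / (32 alpha^3) the
   standard nilpotent generators of sl_2. *)
Definition sl2_coord (X : 'M[K]_2) : hmodel alpha :=
  hv 0 0 (X 0 0 / (2%:R * alpha)) (X 1 0 / (32%:R * alpha ^+ 3)) (X 0 1) 0.

(** The entries of [v] are the coordinates along Y, Z_0 and Z_1, in this order. *)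
Definition K3_coord (v : 'rV[K]_3) : hmodel alpha :=
  hv (- (4%:R * alpha) * v 0 i1) (4%:R * alpha * v 0 i2) 0 (v 0 i1) (v 0 i2) (v 0 i0).

Lemma h_decomposition : alpha != 0 ->
  @sl2_plus_K3 _ h
    [:: lie A0 A1; lie A0 (lie A0 A1); lie A1 (lie A0 A1)]
    [:: Y; - (4%:R * alpha) *: A0 + lie A0 (lie A0 A1);
           (4%:R * alpha) *: A1 + lie A1 (lie A0 A1)].
Proof.
move=> a0; have [phi [Hphi Hemb phiK embK]] := hmodel_iso char0 H1 H6 H16 Hh.
have n2 : 2%:R != 0 :> K by exact: char0.
have n4 : 4%:R != 0 :> K by exact: char0.
have n32 : 32%:R != 0 :> K by exact: char0.
have emb_inj : injective emb := can_inj embK.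
exists (fun X => emb (sl2_coord X)), (fun v => emb (K3_coord v)).
split=> [a X X'|a v v'|X X' v v' trX trX'|X v trX|].
- rewrite -Hemb.1 /sl2_coord !hvecZ !hvecD !mxE; congr (emb _); congr hvec; ring.
- rewrite -Hemb.1 /K3_coord !hvecZ !hvecD !mxE; congr (emb _); congr hvec; ring.
- rewrite -!(lie_homD Hemb) -Hemb.2 /sl2_coord /K3_coord !hvecD lie_hvec.
  rewrite !commmx2E (tr0_diag trX) (tr0_diag trX').
  by congr (emb _); congr hvec; field; rewrite ?n2 ?n32 ?a0.
- rewrite -(lie_homD Hemb) -(lie_hom0 Hemb) => /emb_inj.
  rewrite /sl2_coord /K3_coord hvecD hvec0 => /hvec_inj[].
  rewrite !(add0r, addr0) => -[e0 e1 ec] [e2 e3 ey].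
  have v1 : v 0 i1 = 0.
    by move/eqP: e0; rewrite mulf_eq0 oppr_eq0 mulf_eq0 (negPf n4) (negPf a0) => /eqP.
  have v2 : v 0 i2 = 0.
    by move/eqP: e1; rewrite !mulf_eq0 (negPf n4) (negPf a0) => /eqP.
  rewrite v1 addr0 in e2; rewrite v2 addr0 in e3.
  have X00 : X 0 0 = 0.
    move/eqP: ec; rewrite mulf_eq0 invr_eq0 mulf_eq0 (negPf n2) (negPf a0) !orbF.
    by move/eqP.
  have X10 : X 1 0 = 0.
    move/eqP: e2; rewrite mulf_eq0 invr_eq0 mulf_eq0 expf_eq0 (negPf n32) (negPf a0) !orbF.
    by move/eqP.
  split; [apply: mx2P|apply: rV3P]; rewrite ?mxE //.
  by rewrite tr0_diag // X00 oppr0.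
(* The inverse of [sl2_coord] on the span of E_1, E_2, E_3: the scaling factors are undone. *)
pose mxX a b c : 'M[K]_2 := \matrix_(i, j)
  (if i == 0 then if j == 0 then a * (2%:R * alpha) else c
   else if j == 0 then b * (32%:R * alpha ^+ 3) else - (a * (2%:R * alpha))).
have tr_mxX a b c : \tr (mxX a b c) = 0 by rewrite mxtrace2E !mxE /= subrr.
have mxXE a b c : sl2_coord (mxX a b c) = hv 0 0 a b c 0.
  rewrite /sl2_coord !mxE /=; congr hvec; field; rewrite ?n2 ?n32 ?a0 //.
pose rv a b c : 'rV[K]_3 := \row_j [:: a; b; c]`_j.
have rvE a b c : K3_coord (rv a b c) =
    hv (- (4%:R * alpha) * b) (4%:R * alpha * c) 0 b c a.
  by rewrite /K3_coord !mxE.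
split=> [y|y|y].
- rewrite -[y]phiK; have [x0 [x1 [xc [x2 [x3 [x4 ->]]]]]] := hvecP (phi y).
  (* The witnesses come from A_0 = (E_2 - Z_0) / (4 alpha) and A_1 = (Z_1 - E_3) / (4 alpha). *)
  exists (mxX xc (x2 + x0 / (4%:R * alpha)) (x3 - x1 / (4%:R * alpha))).
  exists (rv x4 (- (x0 / (4%:R * alpha))) (x1 / (4%:R * alpha))).
  rewrite tr_mxX -(lie_homD Hemb) mxXE rvE hvecD; split=> //.
  by congr (emb _); congr hvec; field; rewrite ?n4 ?a0.
- rewrite in_span3; split=> [[a [b [c ->]]]|[X [_ ->]]].
    exists (mxX a b c); rewrite tr_mxX mxXE hembedE; split=> //.
    by lmod_eq K h by ring.
  do 3 eexists; rewrite /sl2_coord hembedE !scale0r !add0r addr0.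
  reflexivity.
- rewrite in_span3; split=> [[a [b [c ->]]]|[v ->]].
    exists (rv a b c); rewrite rvE hembedE; lmod_eq K h by ring.
  exists (v 0 i0), (v 0 i1), (v 0 i2).
  rewrite /K3_coord hembedE; lmod_eq K h by ring.
Qed.

Lemma h_dim_le6 : dim_le h 6.
Proof.
have [phi [_ _ phiK _]] := hmodel_iso char0 H1 H6 H16 Hh.
pose s := [:: A0; A1; lie A0 A1; lie A0 (lie A0 A1); lie A1 (lie A0 A1); Y].
exists s; split=> // v; rewrite -[v]phiK.
have [x0 [x1 [xc [x2 [x3 [x4 ->]]]]]] := hvecP (phi v).
exists (fun i => [:: x0; x1; xc; x2; x3; x4]`_i).
by rewrite !big_ord_recl big_ord0 addr0 hembedE /= !addrA.
Qed.

Lemma h_nilpotent : alpha = 0 -> nilpotent h.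
Proof.
move=> alpha0; have [phi [Hphi _ phiK _]] := hmodel_iso char0 H1 H6 H16 Hh.
(* For alpha = 0 the bracket only sees the coordinates of A_0, A_1 and E_1. So the first term of the
   series lies in the span of E_1, E_2, E_3, the second in that of E_2, E_3, and the third is 0. *)
have lcs_phi n x : lcs n x -> exists x0 x1 xc x2 x3 x4,
    [/\ phi x = hv x0 x1 xc x2 x3 x4,
        (0 < n)%N -> [/\ x0 = 0, x1 = 0 & x4 = 0],
        (1 < n)%N -> xc = 0 & (2 < n)%N -> x2 = 0 /\ x3 = 0].
  elim=> {n x} [x|n x y _ IH|n|n x y _ IHx _ IHy|n a x _ IH].
  - have [x0 [x1 [xc [x2 [x3 [x4 E]]]]]] := hvecP (phi x).
    by exists x0, x1, xc, x2, x3, x4.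
  - have [x0 [x1 [xc [x2 [x3 [x4 Ex]]]]]] := hvecP (phi x).
    have [y0 [y1 [yc [y2 [y3 [y4 [Ey P1 P2 P3]]]]]]] := IH.
    rewrite Hphi.2 Ex Ey lie_hvec; do 6 eexists; split; first by [].
    + by [].
    + by rewrite ltnS alpha0 => /P1[-> -> _]; ring.
    + move=> lt2n; have [-> -> _] := P1 (ltnW lt2n).
      by rewrite (P2 lt2n) alpha0; split; ring.
  - exists 0, 0, 0, 0, 0, 0; split=> //.
    by rewrite (lie_hom0 Hphi) hvec0.
  - have [x0 [x1 [xc [x2 [x3 [x4 [Ex P1 P2 P3]]]]]]] := IHx.
    have [y0 [y1 [yc [y2 [y3 [y4 [Ey Q1 Q2 Q3]]]]]]] := IHy.
    rewrite (lie_homD Hphi) Ex Ey hvecD; do 6 eexists; split; first by [].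
    + by have [-> -> ->] := P1 isT; have [-> -> ->] := Q1 isT; rewrite addr0.
    + by move=> lt1; rewrite P2 // Q2 // addr0.
    + by move=> lt2; have [-> ->] := P3 lt2; have [-> ->] := Q3 lt2; rewrite addr0.
  - have [x0 [x1 [xc [x2 [x3 [x4 [Ex P1 P2 P3]]]]]]] := IH.
    rewrite (lie_homZ Hphi) Ex hvecZ; do 6 eexists; split; first by [].
    + by have [-> -> ->] := P1 isT; rewrite mulr0.
    + by move=> lt1; rewrite P2 // mulr0.
    + by move=> lt2; have [-> ->] := P3 lt2; rewrite mulr0.
exists 3%N => x /lcs_phi[x0 [x1 [xc [x2 [x3 [x4 [E P1 P2 P3]]]]]]].
have [e0 e1 e4] := P1 isT; have [e2 e3] := P3 isT.
rewrite -[x]phiK E e0 e1 e2 e3 e4 P2 // hembedE.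
by lmod_eq K h by ring.
Qed.
End Decomposition.

(** * Elimination in the prolongation identity *)

Section LinearRules.
Variables (K : fieldType) (V W : lmodType K) (f : V -> W) (Hf : linear f).
Lemma linfD x y : f (x + y) = f x + f y.
Proof. by have := Hf 1 x y; rewrite !scale1r. Qed.
Lemma linf0 : f 0 = 0.
Proof. by have := Hf (-1) 0 0; rewrite scaler0 addr0 scaleN1r addNr. Qed.
Lemma linfZ a x : f (a *: x) = a *: f x.
Proof. by have := Hf a x 0; rewrite !addr0 linf0 addr0. Qed.
Lemma linfN x : f (- x) = - f x.
Proof. by rewrite -scaleN1r linfZ scaleN1r. Qed.
Definition linfE := (linfD, linfN, linfZ, linf0).
End LinearRules.

Section Elimination.
Variables (K : fieldType) (char0 : forall n : nat, n.+1%:R != 0 :> K).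
(** [D k] and [U k] abstract the partial derivative by u_k and multiplication by u_k. Working from
    the Weyl algebra relations alone keeps the base point and the coefficients of the series out of
    the elimination. *)
Variables (S : lmodType K) (D U : nat -> S -> S).
Hypotheses (Dlin : forall k, linear (D k)) (Ulin : forall k, linear (U k)).
(** The bounds matter because [uk] sends every index from 6 on to 0. *)
Hypothesis DU : forall k l x, (k < 6)%N -> (l < 6)%N ->
  D k (U l x) = U l (D k x) + (k == l)%:R *: x.
Hypothesis DD : forall k l x, D k (D l x) = D l (D k x).
Hypothesis UU : forall k l x, U k (U l x) = U l (U k x).

Let DUE := (fun k => linfD (Dlin k), fun k => linfN (Dlin k),
  fun k => linfZ (Dlin k), fun k => linf0 (Dlin k), fun k => linfD (Ulin k),
  fun k => linfN (Ulin k), fun k => linfZ (Ulin k), fun k => linf0 (Ulin k)).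

Lemma eq_from0 (V : zmodType) (e x y : V) : e = 0 -> x - y = e -> x = y.
Proof. by move=> -> /eqP; rewrite subr_eq0 => /eqP. Qed.

(** [L] stands for the bracket with A, [A'] for dA/du_0, and F = u_5 + p u_1 u_2 + q u_0 u_3 - r
    u_0^2 u_1. *)
Definition WE_expr (p q r : K) (L : S -> S) (A' B : S) : S :=
  U 1 (D 0 B) + U 2 (D 1 B) + U 3 (D 2 B) + U 4 (D 3 B) + U 5 (D 4 B)
  - (U 5 A' + p *: U 1 (U 2 A') + q *: U 0 (U 3 A') - r *: U 0 (U 0 (U 1 A')))
  + L B.

Section HigherOrder.
(** Here [A1], [A2], [A3] are the first three derivatives of the series A by u_0, not generators of
    h. *)
Variables (p q r : K) (L : S -> S) (B A1 A2 A3 : S).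
Hypothesis Llin : linear L.
Hypothesis DL : forall k x, (0 < k < 6)%N -> D k (L x) = L (D k x).
Hypothesis DA1 : forall k, (0 < k < 6)%N -> D k A1 = 0.
Hypotheses (A2E : D 0 A1 = A2) (A3E : D 0 A2 = A3).
Hypothesis D5B : D 5 B = 0.
Hypothesis WE : WE_expr p q r L A1 B = 0.

Let LE := (DUE, linfE Llin).

Let DA2 k : (0 < k < 6)%N -> D k A2 = 0.
Proof. by move=> lt_k; rewrite -A2E DD DA1 // linf0 //. Qed.

Let DA3 k : (0 < k < 6)%N -> D k A3 = 0.
Proof. by move=> lt_k; rewrite -A3E DD DA2 // linf0 //. Qed.

Let DLE := (fun x => @DL 1 x isT, fun x => @DL 2 x isT, fun x => @DL 3 x isT,
  fun x => @DL 4 x isT, fun x => @DL 5 x isT).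
Let DAE := (A2E, A3E, @DA1 1 isT, @DA1 2 isT, @DA1 3 isT, @DA1 4 isT, @DA1 5 isT,
  @DA2 1 isT, @DA2 2 isT, @DA2 3 isT, @DA2 4 isT, @DA2 5 isT,
  @DA3 1 isT, @DA3 2 isT, @DA3 3 isT, @DA3 4 isT, @DA3 5 isT).

Ltac push_D := rewrite ?LE; do ?[rewrite DU //=];
  rewrite ?(mulr0n, mulr1n, scale0r, scale1r, addr0);
  rewrite ?(LE, DLE, DAE, scaler0, addr0, add0r, oppr0).

(** First step of a descent: applying [D k] to the identity releases [D (k - 1) B] from the term
    [U k (D (k - 1) B)], and the other terms are known from the previous steps. *)
Lemma WE_D4 : D 4 B = A1.
Proof.
have := congr1 (D 5) WE; rewrite /WE_expr; push_D.
rewrite !(DD 5) D5B; push_D => H.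
by apply: eq_from0 H _; lmod_eq K S by ring.
Qed.

Lemma WE_D3 : D 3 B = - U 1 A2 - L A1.
Proof.
have := congr1 (D 4) WE; rewrite /WE_expr; push_D; rewrite WE_D4.
rewrite (DD 4 0) (DD 4 1) (DD 4 2) (DD 4 3) WE_D4; push_D => H.
by apply: eq_from0 H _; lmod_eq K S by ring.
Qed.

Lemma WE_D2 : D 2 B =
  U 1 (U 1 A3) + U 1 (D 0 (L A1)) + U 2 A2 + q *: U 0 A1 + L (U 1 A2) + L (L A1).
Proof.
have := congr1 (D 3) WE; rewrite /WE_expr; push_D; rewrite WE_D4.
rewrite (DD 3 0) (DD 3 1) (DD 3 2) WE_D3; push_D => H.
by apply: eq_from0 H _; lmod_eq K S by ring.
Qed.

(** The first compatibility condition: the second derivative of the identity by u_2 involves B only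
    through derivatives that are already known. The factor 2 multiplies [D 1 (D 2 B)]. *)
Lemma WE_D22 : U 1 A3 + 2%:R *: (2%:R *: U 1 A3 + D 0 (L A1) + L A2) + L A2 = 0.
Proof.
have D22 : D 2 (D 2 B) = A2 by rewrite WE_D2; push_D; rewrite !(DD 2 0); push_D.
have D12 : D 1 (D 2 B) = 2%:R *: U 1 A3 + D 0 (L A1) + L A2.
  rewrite WE_D2; push_D; rewrite !(DD 1 0); push_D.
  by lmod_eq K S by ring.
have D23 : D 2 (D 3 B) = 0 by rewrite WE_D3; push_D.
have := congr1 (fun x => D 2 (D 2 x)) WE.
rewrite /WE_expr; push_D; push_D.
rewrite !(DD 2 0) !(DD 2 1) WE_D4 D23 D22; push_D => H.
by rewrite -[RHS]H D12; lmod_eq K S by ring.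
Qed.

(** The derivative of [WE_D22] by u_1 is 5 [A3], so A is at most quadratic in u_0; the second
    equation is what remains of [WE_D22]. *)
Lemma WE_A3 : A3 = 0 /\ 2%:R *: D 0 (L A1) + 3%:R *: L A2 = 0.
Proof.
have A3_0 : A3 = 0.
  have := congr1 (D 1) WE_D22; push_D; rewrite !(DD 1 0); push_D => H.
  apply: (@scaler_cancel _ _ 5%:R); first exact: char0.
  by rewrite -[RHS]H; lmod_eq K S by ring.
split=> //; rewrite -[RHS]WE_D22 A3_0 (linf0 (Ulin 1)); lmod_eq K S by ring.
Qed.
End HigherOrder.

Section LowOrder.
(** [C] abstracts the constant series and [l X] the coefficientwise action of ad X. *)
Variables (M : lieAlgType K) (C : M -> S) (l : M -> S -> S).
Hypotheses (Clin : linear C) (llin : forall X, linear (l X)).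
Hypothesis DC : forall k X, (k < 6)%N -> D k (C X) = 0.
Hypothesis Cinj : forall X, C X = 0 -> X = 0.
Hypothesis lU : forall X k x, l X (U k x) = U k (l X x).
Hypothesis lD : forall X k x, l X (D k x) = D k (l X x).
Hypothesis lC : forall X Y, l X (C Y) = C (lie X Y).

Let ClE := (linfE Clin, fun X => linfD (llin X), fun X => linfN (llin X),
  fun X => linfZ (llin X), fun X => linf0 (llin X), lU, lC).
Let DCE := (fun X => @DC 0 X isT, fun X => @DC 1 X isT, fun X => @DC 2 X isT,
  fun X => @DC 3 X isT, fun X => @DC 4 X isT, fun X => @DC 5 X isT).
Let sortU := (UU 1 0, UU 2 0, UU 2 1, UU 3 0, UU 3 1, UU 3 2,
  UU 4 0, UU 4 1, UU 4 2, UU 4 3, UU 5 0, UU 5 1, UU 5 2, UU 5 3, UU 5 4).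

Ltac simp0 := rewrite ?(mulr0n, mulr1n, scale0r, scale1r, scaler0, addr0, add0r, oppr0).
Ltac push := rewrite ?(DUE, ClE, DCE, lieE); do ?[rewrite DU //=];
  simp0; rewrite ?(DUE, ClE, DCE, lieE); simp0; rewrite ?sortU.

(** The coefficients of a polynomial in u_0 are read off from the top by differentiation. *)
Lemma const_poly1 X Y : C X + U 0 (C Y) = 0 -> X = 0 /\ Y = 0.
Proof.
move=> H; have Y0 : Y = 0.
  by apply: Cinj; have := congr1 (D 0) H; push.
by split=> //; apply: Cinj; rewrite -[RHS]H Y0; push.
Qed.

Lemma const_poly3 X0 X1 X2 X3 :
  C X0 + U 0 (C X1) + U 0 (U 0 (C X2)) + U 0 (U 0 (U 0 (C X3))) = 0 ->
  [/\ X0 = 0, X1 = 0, X2 = 0 & X3 = 0].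
Proof.
move=> H; have e3 : X3 = 0.
  apply: Cinj; apply: (@scaler_cancel _ _ 6%:R); first exact: char0.
  have := congr1 (fun x => D 0 (D 0 (D 0 x))) H; do 4 push; move=> <-.
  by lmod_eq K S by ring.
have e2 : X2 = 0.
  apply: Cinj; apply: (@scaler_cancel _ _ 2%:R); first exact: char0.
  have := congr1 (fun x => D 0 (D 0 x)) H; rewrite e3; do 4 push; move=> <-.
  by lmod_eq K S by ring.
by move: H; rewrite e2 e3; push => /const_poly1[-> ->].
Qed.

Section Potential.
Variables (alpha beta : K) (X0 X1 : M).
Local Notation w := (lie X0 X1).

(* Found by integrating the equations for D 4 B, ..., D 0 B successively; Y is the
   constant of integration. *)
Definition B_poly (Y : M) : S :=
  U 4 (C X1) - U 3 (C w)
  + U 2 ((8%:R * alpha - 2%:R * beta) *: U 0 (C X1) + C (lie X0 w) + U 0 (C (lie X1 w)))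
  - 2%:R^-1 *: U 1 (U 1 ((4%:R * alpha + 4%:R * beta) *: C X1 + C (lie X1 w)))
  - U 1 (C (lie X0 (lie X0 w)) - (2%:R * beta) *: U 0 (C w))
  + U 0 (C (lie X0 (lie X0 (lie X0 w))))
  + 2%:R^-1 *: U 0 (U 0 (C (lie X1 (lie X0 (lie X0 w)))
                        - (2%:R * beta) *: C (lie X0 w)))
  - 3%:R^-1 *: U 0 (U 0 (U 0 ((2%:R * beta) *: C (lie X1 w)
                              + (20%:R * alpha * beta) *: C X1)))
  + C Y.

Hypotheses (R1 : lie X1 (lie X1 w) = 0)
  (R2 : (4%:R * alpha) *: w + lie X0 (lie X1 w) = 0).

Lemma ad0_ad1_w : lie X0 (lie X1 w) = - (4%:R * alpha) *: w.
Proof. by move/eqP: R2; rewrite addrC addr_eq0 scaleNr => /eqP. Qed.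

Lemma ad1_ad0_w : lie X1 (lie X0 w) = - (4%:R * alpha) *: w.
Proof.
by rewrite (lie_deriv X1 X0 w) (lie_anti X1 X0) lieNx lie_alt oppr0 add0r ad0_ad1_w.
Qed.

Ltac push_poly := rewrite /B_poly; do 3 push; rewrite ?lie_alt; do 2 push.

Lemma D0_B_poly Y : D 0 (B_poly Y) =
  (8%:R * alpha - 2%:R * beta) *: U 2 (C X1) + U 2 (C (lie X1 w))
  + (2%:R * beta) *: U 1 (C w) + C (lie X0 (lie X0 (lie X0 w)))
  + U 0 (C (lie X1 (lie X0 (lie X0 w)))) - (2%:R * beta) *: U 0 (C (lie X0 w))
  - (2%:R * beta) *: U 0 (U 0 (C (lie X1 w)))
  - (20%:R * alpha * beta) *: U 0 (U 0 (C X1)).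
Proof.
have [n2 n3] : 2%:R != 0 :> K /\ 3%:R != 0 :> K by split; apply: char0.
by push_poly; lmod_eq K S by field; rewrite ?n2 ?n3.
Qed.

Lemma D1_B_poly Y : D 1 (B_poly Y) =
  - (4%:R * alpha + 4%:R * beta) *: U 1 (C X1) - U 1 (C (lie X1 w))
  - C (lie X0 (lie X0 w)) + (2%:R * beta) *: U 0 (C w).
Proof.
have n2 : 2%:R != 0 :> K by apply: char0.
by push_poly; lmod_eq K S by field; rewrite ?n2.
Qed.

Lemma D2_B_poly Y : D 2 (B_poly Y) =
  (8%:R * alpha - 2%:R * beta) *: U 0 (C X1) + C (lie X0 w) + U 0 (C (lie X1 w)).
Proof. by push_poly. Qed.

Lemma D3_B_poly Y : D 3 (B_poly Y) = - C w.
Proof. by push_poly. Qed.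

Lemma D4_B_poly Y : D 4 (B_poly Y) = C X1.
Proof. by push_poly. Qed.

Lemma D5_B_poly Y : D 5 (B_poly Y) = 0.
Proof. by push_poly. Qed.

(** Given the first two relations of h, the identity becomes a cubic in u_0 whose coefficients are
    the other four relations. This serves both directions of the correspondence. *)
Lemma WE_B_poly (Y : M) (L : S -> S) (A1 : S) :
  (forall x, L x = l X0 x + U 0 (l X1 x)) -> A1 = C X1 ->
  WE_expr (4%:R * alpha - 6%:R * beta) (8%:R * alpha - 2%:R * beta)
    (20%:R * alpha * beta) L A1 (B_poly Y) =
  C (lie X0 Y) + U 0 (C (lie X1 Y + lie X0 (lie X0 (lie X0 (lie X0 w)))))
  + U 0 (U 0 (C (lie X1 (lie X0 (lie X0 (lie X0 w))) - beta *: lie X0 (lie X0 w)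
                 + 2%:R^-1 *: lie X0 (lie X1 (lie X0 (lie X0 w))))))
  + U 0 (U 0 (U 0 (C (2%:R^-1 *: lie X1 (lie X1 (lie X0 (lie X0 w))))))).
Proof.
move=> LX ->.
have [n2 n3] : 2%:R != 0 :> K /\ 3%:R != 0 :> K by split; apply: char0.
rewrite /WE_expr D0_B_poly D1_B_poly D2_B_poly D3_B_poly D4_B_poly LX /B_poly.
push; push; rewrite ?lie_alt ?(ad0_ad1_w, ad1_ad0_w, R1); push.
rewrite ?(ad0_ad1_w, ad1_ad0_w, R1); push.
by lmod_eq K S by field; rewrite ?n2 ?n3.
Qed.
End Potential.

Section Solve.
(** The case A = X0 + u_0 X1 + u_0^2 X2, to which [WE_A3] reduces. *)
Variables (p q r : K) (L : S -> S) (A1 B : S) (X0 X1 X2 : M).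
Hypothesis LX : forall x, L x = l X0 x + U 0 (l X1 x) + U 0 (U 0 (l X2 x)).
Hypothesis A1X : A1 = C X1 + 2%:R *: U 0 (C X2).
Hypothesis D5B : D 5 B = 0.
Hypothesis WE : WE_expr p q r L A1 B = 0.

Let Llin : linear L.
Proof.
move=> c x y; rewrite !LX; push.
by lmod_eq K S by ring.
Qed.

Let DL k x : (0 < k < 6)%N -> D k (L x) = L (D k x).
Proof.
case/andP=> k_gt0 k_lt6; rewrite !LX; push; rewrite !(gtn_eqF k_gt0); push.
by rewrite -!lD.
Qed.

Let DA1 k : (0 < k < 6)%N -> D k A1 = 0.
Proof.
case/andP=> k_gt0 k_lt6; rewrite A1X; push; rewrite !(gtn_eqF k_gt0).
by rewrite !DC //; push.
Qed.

Let A2 := 2%:R *: C X2.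
Let D0A1 : D 0 A1 = A2.
Proof. by rewrite A1X; push. Qed.
Let D0A2 : D 0 A2 = 0.
Proof. by rewrite /A2; push. Qed.

(** The second equation of [WE_A3] is linear in u_0, with coefficients 10 [X0, X2] and 10
    [X1, X2]. *)
Lemma leading_central : lie X0 X2 = 0 /\ lie X1 X2 = 0.
Proof.
have [_] := WE_A3 Llin DL DA1 D0A1 D0A2 D5B WE.
rewrite A1X /A2 !LX; do 4 push; rewrite !lie_alt (lie_anti X2 X1); do 2 push; move=> H.
apply: const_poly1; apply: (@scaler_cancel _ _ 10%:R); first exact: char0.
by rewrite -[RHS]H; lmod_eq K S by ring.
Qed.

Local Notation w := (lie X0 X1).

Lemma X2_central :
  [/\ lie X0 X2 = 0, lie X1 X2 = 0, lie X2 X0 = 0 & lie X2 X1 = 0] /\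
  [/\ lie X2 w = 0, lie X2 (lie X0 w) = 0 & lie X2 (lie X1 w) = 0].
Proof.
have [z02 z12] := leading_central.
have z20 : lie X2 X0 = 0 by rewrite lie_anti z02 oppr0.
have z21 : lie X2 X1 = 0 by rewrite lie_anti z12 oppr0.
by rewrite !(lie_deriv X2) z20 z21 !(lie0x, liex0, addr0).
Qed.

Ltac push_central :=
  let z02 := fresh "z02" in let z12 := fresh "z12" in let z20 := fresh "z20" in
  let z21 := fresh "z21" in let z2w := fresh "z2w" in let z20w := fresh "z20w" in
  let z21w := fresh "z21w" in
  have [[z02 z12 z20 z21] [z2w z20w z21w]] := X2_central;
  do 4 push; rewrite ?lie_alt ?(z02, z12, z20, z21, z2w, z20w, z21w); push.

Let D4BE : D 4 B = C X1 + 2%:R *: U 0 (C X2).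
Proof. by rewrite (WE_D4 Llin DL DA1 D5B WE). Qed.

Let D3BE : D 3 B = - (2%:R *: U 1 (C X2)) - C w.
Proof.
rewrite (WE_D3 Llin DL DA1 D0A1 D5B WE) LX /A2 A1X; push_central.
by lmod_eq K S by ring.
Qed.

Let D2BE : D 2 B = 2%:R *: U 2 (C X2) + q *: U 0 (C X1)
  + (2%:R * q) *: U 0 (U 0 (C X2)) + C (lie X0 w) + U 0 (C (lie X1 w)).
Proof.
rewrite (WE_D2 Llin DL DA1 D0A1 D0A2 D5B WE) !LX /A2 A1X; push_central.
by lmod_eq K S by ring.
Qed.

Let D1BE : D 1 B = - ((q - p) *: U 1 (C X1)
  + (4%:R * q - 2%:R * p) *: U 0 (U 1 (C X2)) + U 1 (C (lie X1 w))
  + 2%:R *: U 3 (C X2) + q *: U 0 (C w)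
  + C (lie X0 (lie X0 w)) + U 0 (C (lie X1 (lie X0 w)))
  + U 0 (C (lie X0 (lie X1 w))) + U 0 (U 0 (C (lie X1 (lie X1 w))))).
Proof.
have := congr1 (D 2) WE; rewrite /WE_expr; do 2 push; rewrite DL //.
rewrite !(DD 2 0) !(DD 2 1) D4BE D3BE D2BE A1X LX.
push_central => H.
by apply: eq_from0 H _; lmod_eq K S by ring.
Qed.

Let D11BE : D 1 (D 1 B) = - ((q - p) *: C X1
  + (4%:R * q - 2%:R * p) *: U 0 (C X2) + C (lie X1 w)).
Proof. by rewrite D1BE; do 4 push. Qed.

Let D0BE : D 0 B = - (U 1 (D 0 (D 1 B)) + U 2 (D 1 (D 1 B))
  - 2%:R *: U 4 (C X2) - p *: U 2 A1 + r *: U 0 (U 0 A1) + L (D 1 B)).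
Proof.
have D12 : D 1 (D 2 B) = 0 by rewrite D2BE; do 2 push.
have D13 : D 1 (D 3 B) = - (2%:R *: C X2) by rewrite D3BE; do 2 push.
have D14 : D 1 (D 4 B) = 0 by rewrite D4BE; do 2 push.
have := congr1 (D 1) WE; rewrite /WE_expr; do 2 push; rewrite DL // (DD 1 0).
rewrite D12 D13 D14 !DA1 //; push => H.
by apply: eq_from0 H _; lmod_eq K S by ring.
Qed.

(** Equality of the mixed derivatives of B by u_0 and u_1, one side being computed from [D0BE]. *)
Let D011BE :
  2%:R *: D 0 (D 1 B) + U 1 (D 0 (D 1 (D 1 B))) + L (D 1 (D 1 B)) = 0.
Proof.
have D111 : D 1 (D 1 (D 1 B)) = 0 by rewrite D11BE; do 2 push.
have := congr1 (D 1) D0BE; rewrite (DD 1 0).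
do 2 push; rewrite !(DD 1 0) D111 DA1 // DL //; do 2 push; move/eqP.
rewrite -subr_eq0 => /eqP H; rewrite -[RHS]H.
by lmod_eq K S by ring.
Qed.

(** The derivative of [D011BE] by u_1 is -6 (2 q - p) X2. *)
Lemma quadratic_coef0 : 2%:R * q - p != 0 -> X2 = 0.
Proof.
move=> pq; have := congr1 (D 1) D011BE; rewrite D11BE.
do 2 push; rewrite (DD 1 0) D11BE DL //; do 4 push; move=> H.
apply: Cinj; apply: (@scaler_cancel _ _ (2%:R * q - p)) => //.
apply: (@scaler_cancel _ _ (- 6%:R)); first by rewrite oppr_eq0 char0.
by rewrite -[RHS]H (linf0 Llin); do 3 push; lmod_eq K S by ring.
Qed.

(** When X2 = 0, [D011BE] is a polynomial of degree one in u_0 alone; the two equations are its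
    coefficients. *)
Lemma linear_coef_rel : X2 = 0 ->
  lie X1 (lie X1 w) = 0 /\ (3%:R * q - p) *: w + 5%:R *: lie X0 (lie X1 w) = 0.
Proof.
move=> X2_0; have := D011BE.
have jac : lie X1 (lie X0 w) = lie X0 (lie X1 w).
  by rewrite (lie_deriv X1 X0 w) (lie_anti X1 X0) lieNx lie_alt oppr0 add0r.
rewrite D11BE D1BE LX X2_0 jac; do 4 push; rewrite ?lie_alt; push => H.
have [] : (3%:R * q - p) *: w + 5%:R *: lie X0 (lie X1 w) = 0 /\
  5%:R *: lie X1 (lie X1 w) = 0.
  apply: const_poly1; rewrite !(linfE Clin) -[RHS]oppr0 -[in RHS]H.
  by do 2 push; lmod_eq K S by ring.
by move=> ? /scaler_cancel-> //; apply: char0.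
Qed.

(** Equal partial derivatives make B and the explicit polynomial differ by a constant, which will be
    Y. *)
Lemma D_B_poly (alpha beta : K) k : X2 = 0 -> lie X1 (lie X1 w) = 0 ->
  (4%:R * alpha) *: w + lie X0 (lie X1 w) = 0 ->
  p = 4%:R * alpha - 6%:R * beta -> q = 8%:R * alpha - 2%:R * beta ->
  r = 20%:R * alpha * beta ->
  (k < 6)%N -> D k (B - B_poly alpha beta X0 X1 0) = 0.
Proof.
move=> X2_0 R1 R2 pE qE rE lt_k.
have n2 : 2%:R != 0 :> K by exact: char0.
have n3 : 3%:R != 0 :> K by exact: char0.
have [X01w' X10w'] := (ad0_ad1_w R2, ad1_ad0_w R2).
apply/eqP; rewrite linfD // linfN // subr_eq0; apply/eqP.
have D1B' := D1BE; rewrite X01w' X10w' R1 X2_0 in D1B'.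
case: k lt_k => [|[|[|[|[|[|//]]]]]] _;
  rewrite ?(D0_B_poly, D1_B_poly, D2_B_poly, D3_B_poly, D4_B_poly, D5_B_poly);
  [rewrite D0BE D11BE D1B' LX A1X|rewrite D1B'|rewrite D2BE|rewrite D3BE
  |rewrite D4BE|by rewrite D5B];
  rewrite ?X2_0 ?pE ?qE ?rE; do 3 push; rewrite ?lie_alt;
  do 2 (rewrite ?(X01w', X10w', R1); push);
  by lmod_eq K S by field; rewrite ?n2 ?n3.
Qed.

End Solve.
End LowOrder.
End Elimination.

(** * Formal power series *)

Section SeriesOperators.
Variables (K : fieldType) (M : lieAlgType K) (a : 'I_6 -> K).
Implicit Types (S T : mindex -> M) (m : mindex) (k : 'I_6).

Local Notation D k := (@ps_deriv K M (uk k)).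
Local Notation U k := (@ps_mulu K M a (uk k)).

Definition ps_const (X : M) : mindex -> M :=
  fun m => if [forall k, m k == 0%N] then X else 0.
Definition ps_ad (X : M) S : mindex -> M := fun m => lie X (S m).

Lemma mi_ext m m' : (forall k, m k = m' k) -> m = m'.
Proof. by move=> e; apply: funext. Qed.

Lemma ps_ext S T : (forall m, S m = T m) -> S = T.
Proof. by move=> e; apply: funext. Qed.

Lemma ps_linE c S T m : (c *: S + T) m = c *: S m + T m.
Proof. by []. Qed.

Lemma ps_deriv_linear k : linear (@ps_deriv K M k).
Proof.
move=> c S T; apply: ps_ext => m; rewrite ps_linE /ps_deriv ps_linE.
by lmod_eq K M by ring.
Qed.

Lemma ps_mulu_linear k : linear (@ps_mulu K M a k).
Proof.
move=> c S T; apply: ps_ext => m; rewrite ps_linE /ps_mulu !ps_linE.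
by case: ifP => _; lmod_eq K M by ring.
Qed.

Lemma ps_const_linear : linear ps_const.
Proof.
move=> c X Y; apply: ps_ext => m; rewrite ps_linE /ps_const.
by case: ifP => _; rewrite ?scaler0 ?addr0.
Qed.

Lemma ps_ad_linear X : linear (ps_ad X).
Proof. by move=> c S T; apply: ps_ext => m; rewrite ps_linE /ps_ad ps_linE lieDr. Qed.

Lemma mi_up_down m k l : k != l -> mi_down (mi_up m k) l = mi_up (mi_down m l) k.
Proof.
move=> kl; apply: mi_ext => j; rewrite /mi_down /mi_up.
by case: (eqVneq j l) => // ->; rewrite eq_sym (negPf kl).
Qed.

Lemma mi_upK m k : mi_down (mi_up m k) k = m.
Proof. by apply: mi_ext => j; rewrite /mi_down /mi_up; case: eqP. Qed.

Lemma mi_downK m k : (0 < m k)%N -> mi_up (mi_down m k) k = m.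
Proof.
move=> mk; apply: mi_ext => j; rewrite /mi_down /mi_up.
by case: eqP => // ->; rewrite prednK.
Qed.

Lemma mi_upC m k l : mi_up (mi_up m k) l = mi_up (mi_up m l) k.
Proof.
apply: mi_ext => j; rewrite /mi_up.
by case: (j == k); case: (j == l).
Qed.

Lemma mi_downC m k l : mi_down (mi_down m k) l = mi_down (mi_down m l) k.
Proof.
apply: mi_ext => j; rewrite /mi_down.
by case: (j == k); case: (j == l).
Qed.

Lemma ps_deriv_mulu k l S : ps_deriv k (ps_mulu a l S) =
  ps_mulu a l (ps_deriv k S) + (k == l)%:R *: S.
Proof.
apply: ps_ext => m; rewrite -[RHS]/(ps_mulu a l (ps_deriv k S) m + (k == l)%:R *: S m).
rewrite /ps_deriv /ps_mulu; case: (eqVneq k l) => [<-|kl].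
  rewrite mi_upK {2}/mi_up eqxx /= scale1r; case: ifP => mk.
    rewrite mi_downK // /mi_down eqxx prednK // -natr1.
    by lmod_eq K M by ring.
  (* At exponent 0 the shifted term of [ps_mulu] is absent, and the factor [(m k).+1] = 1 supplies
     exactly the extra copy of [S m]. *)
  have -> : m k = 0%N by move: mk; case: (m k).
  by lmod_eq K M by ring.
rewrite (mi_up_down _ kl) {2}/mi_up eq_sym (negPf kl) scale0r addr0.
case: ifP => ml; last by lmod_eq K M by ring.
rewrite {2}/mi_down (negPf kl).
by lmod_eq K M by ring.
Qed.

Lemma ps_derivC k l S : ps_deriv k (ps_deriv l S) = ps_deriv l (ps_deriv k S).
Proof.
apply: ps_ext => m; case: (eqVneq k l) => [-> //|kl].
rewrite /ps_deriv !scalerA mi_upC.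
have -> : mi_up m k l = m l by rewrite /mi_up eq_sym (negPf kl).
have -> : mi_up m l k = m k by rewrite /mi_up (negPf kl).
by rewrite mulrC.
Qed.

Lemma ps_muluC k l S : ps_mulu a k (ps_mulu a l S) = ps_mulu a l (ps_mulu a k S).
Proof.
apply: ps_ext => m; rewrite /ps_mulu mi_downC.
case: (eqVneq k l) => [-> //|kl].
have -> : mi_down m k l = m l by rewrite /mi_down eq_sym (negPf kl).
have -> : mi_down m l k = m k by rewrite /mi_down (negPf kl).
by case: ifP => _; case: ifP => _; lmod_eq K M by ring.
Qed.

Lemma ps_ad_mulu X k S : ps_ad X (ps_mulu a k S) = ps_mulu a k (ps_ad X S).
Proof.
apply: ps_ext => m; rewrite /ps_ad /ps_mulu liexD liexZ.
by case: ifP => _; rewrite ?liex0.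
Qed.

Lemma ps_ad_deriv X k S : ps_ad X (ps_deriv k S) = ps_deriv k (ps_ad X S).
Proof. by apply: ps_ext => m; rewrite /ps_ad /ps_deriv liexZ. Qed.

Lemma ps_ad_const X Y : ps_ad X (ps_const Y) = ps_const (lie X Y).
Proof. by apply: ps_ext => m; rewrite /ps_ad /ps_const; case: ifP; rewrite ?liex0. Qed.

Lemma ps_deriv_const k X : ps_deriv k (ps_const X) = 0.
Proof.
apply: ps_ext => m; rewrite /ps_deriv /ps_const.
case: forallP => [/(_ k)|]; last by rewrite scaler0.
by rewrite /mi_up eqxx.
Qed.

Definition mi0 : mindex := fun=> 0%N.

Lemma ps_const_at0 X : ps_const X mi0 = X.
Proof. by rewrite /ps_const; case: forallP => // -[] k; rewrite eqxx. Qed.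

Lemma ps_const_inj X : ps_const X = 0 -> X = 0.
Proof. by move=> H; rewrite -[X]ps_const_at0 H. Qed.

(** If m k > 0, the coefficient of S at m, times m k, is the coefficient of dS/du_k at m lowered in
    k; characteristic zero allows the division. *)
Lemma ps_deriv0_const (char0 : forall n : nat, n.+1%:R != 0 :> K) S :
  (forall k, ps_deriv k S = 0) -> S = ps_const (S mi0).
Proof.
move=> DS; apply: ps_ext => m; rewrite /ps_const.
case: forallP => [m0|m_n0]; first by congr S; apply: mi_ext => k; apply/eqP.
have [k mk] : exists k, (0 < m k)%N.
  apply/existsP; rewrite -[[exists k, _]]negbK negb_exists; apply/negP => /forallP m0.
  by apply: m_n0 => k; have := m0 k; rewrite -eqn0Ngt.
have := congr1 (fun T => T (mi_down m k)) (DS k); rewrite /ps_deriv mi_downK //.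
exact: scaler_cancel.
Qed.

(* Only the powers of the 0th variable occur in A, so the product defining the
   bracket is a convolution in that variable. *)
Lemma ps_lie_A (f : WEgen -> M) T m :
  ps_lie (A_ser f) T m = \sum_(i < (m (uk 0)).+1)
    lie (f (inl (i : nat))) (T (fun k => if k == uk 0 then m k - i else m k)%N).
Proof.
rewrite /ps_lie; set N := (\sum_(k < 6) m k)%N.
have le_mN : (m (uk 0) <= N)%N by rewrite /N (bigD1 (uk 0)) //= leq_addr.
(* Exponents outside [supp] contribute 0; those inside are determined by their value at the 0th
   variable, and [h] below is the reindexing. *)
pose supp (p : {ffun 'I_6 -> 'I_N.+1}) := [forall k, (k != uk 0) ==> (p k == 0 :> nat)].
rewrite (bigID supp) /= [X in _ + X]big1 ?addr0; last first.
  by move=> p /andP[_ nsupp]; rewrite /A_ser ifF ?lie0x //; exact: negbTE.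
pose F (i : nat) := lie (f (inl i))
  (T (fun k => if k == uk 0 then m k - i else m k)%N).
rewrite -/(F _) (big_ord_widen N.+1 F) ?ltnS //.
pose h (i : 'I_N.+1) : {ffun 'I_6 -> 'I_N.+1} :=
  [ffun k => if k == uk 0 then i else ord0].
rewrite (reindex_onto h (fun p : {ffun 'I_6 -> 'I_N.+1} => p (uk 0))) /=; last first.
  move=> p /andP[_ /forallP suppp]; apply/ffunP => k; rewrite ffunE.
  case: eqP => [-> //|/eqP k0]; apply: val_inj => /=.
  by have := suppp k; rewrite k0 => /eqP ->.
apply: eq_big => [i|i /andP[/andP[_ Hs] _]].
  rewrite ffunE eqxx eqxx andbT.
  have -> : supp (h i).
    by apply/forallP => k; apply/implyP => /negPf k0; rewrite ffunE k0.
  rewrite andbT ltnS; apply/forallP/idP => [/(_ (uk 0))|le_im k]; first by rewrite ffunE eqxx.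
  by rewrite ffunE; case: eqP => [->|].
rewrite /F /A_ser.
have -> : [forall k, (k != uk 0) ==> (h i k == 0 :> nat)] by exact: Hs.
rewrite ffunE eqxx; congr (lie _ (T _)).
apply: mi_ext => k; rewrite ffunE; case: eqP => // _; exact: subn0.
Qed.
End SeriesOperators.

(** * Solutions of the prolongation identity in a given Lie algebra *)

Section FormalSolutions.
Variables (K : fieldType) (char0 : forall n : nat, n.+1%:R != 0 :> K).
Variables (alpha beta : K) (a : 'I_6 -> K).

Section OneAlgebra.
Variable M : lieAlgType K.

Let S : lmodType K := mindex -> M.
Let D (k : nat) : S -> S := @ps_deriv K M (uk k).
Let U (k : nat) : S -> S := @ps_mulu K M a (uk k).
Let C : M -> S := @ps_const K M.
Let l : M -> S -> S := @ps_ad K M.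

Local Notation p := (4%:R * alpha - 6%:R * beta).
Local Notation q := (8%:R * alpha - 2%:R * beta).
Local Notation r := (20%:R * alpha * beta).

Let Dlin k : linear (D k). Proof. exact: ps_deriv_linear. Qed.
Let Ulin k : linear (U k). Proof. exact: ps_mulu_linear. Qed.
Let Clin : linear C. Proof. exact: ps_const_linear. Qed.
Let llin X : linear (l X). Proof. exact: ps_ad_linear. Qed.

Lemma uk_eq k j : (k < 6)%N -> (j < 6)%N -> (uk k == uk j) = (k == j).
Proof. by move=> lt_k lt_j; rewrite -val_eqE /= !inordK. Qed.

Let DU k j x : (k < 6)%N -> (j < 6)%N ->
  D k (U j x) = U j (D k x) + (k == j)%:R *: x.
Proof. by move=> lt_k lt_j; rewrite /D /U ps_deriv_mulu uk_eq. Qed.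
Let DD k j x : D k (D j x) = D j (D k x). Proof. exact: ps_derivC. Qed.
Let UU k j x : U k (U j x) = U j (U k x). Proof. exact: ps_muluC. Qed.
Let DC k X : (k < 6)%N -> D k (C X) = 0.
Proof. by move=> _; exact: ps_deriv_const. Qed.
Let Cinj X : C X = 0 -> X = 0. Proof. exact: ps_const_inj. Qed.
Let lU X k x : l X (U k x) = U k (l X x). Proof. exact: ps_ad_mulu. Qed.
Let lD X k x : l X (D k x) = D k (l X x). Proof. exact: ps_ad_deriv. Qed.
Let lC X Y : l X (C Y) = C (lie X Y). Proof. exact: ps_ad_const. Qed.

Lemma WE_relE (f : WEgen -> M) : WE_rel alpha beta a f <->
  WE_expr D U p q r (ps_lie (A_ser f)) (D 0 (A_ser f)) (B_ser f) = 0.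
Proof.
have E m : \sum_(k < 5) ps_mulu a (uk k.+1) (ps_deriv (uk k) (B_ser f)) m
    - ps_mulF alpha beta a (ps_deriv (uk 0) (A_ser f)) m
    + ps_lie (A_ser f) (B_ser f) m =
  WE_expr D U p q r (ps_lie (A_ser f)) (D 0 (A_ser f)) (B_ser f) m.
  have sum5 (F : nat -> M) : \sum_(k < 5) F k = F 0%N + F 1%N + F 2%N + F 3%N + F 4%N.
    by rewrite !big_ord_recl big_ord0 addr0 !addrA.
  by rewrite (sum5 (fun k => ps_mulu a (uk k.+1) (ps_deriv (uk k) (B_ser f)) m)).
split=> [H|H m]; first by apply: ps_ext => m; rewrite -E H.
by rewrite E H.
Qed.

Section Family.
Variable f : WEgen -> M.
Local Notation L := (ps_lie (A_ser f)).

Lemma ps_lie_A_linear : linear (L : S -> S).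
Proof.
move=> c x y; apply: ps_ext => m; rewrite ps_linE !ps_lie_A scaler_sumr -big_split.
by apply: eq_bigr => i _; rewrite /= ps_linE lieDr.
Qed.

Lemma ps_deriv_lie_A k (x : S) : k != uk 0 -> ps_deriv k (L x) = L (ps_deriv k x).
Proof.
move=> k0; apply: ps_ext => m; rewrite /ps_deriv !ps_lie_A scaler_sumr.
have -> : mi_up m k (uk 0) = m (uk 0) by rewrite /mi_up eq_sym (negPf k0).
apply: eq_bigr => i _; rewrite (negPf k0) liexZ; congr (_ *: lie _ (x _)); apply: mi_ext => j.
by rewrite /mi_up; case: (eqVneq j k) => [->|//]; rewrite (negPf k0).
Qed.

Lemma D_A_ser k : k != uk 0 -> ps_deriv k (A_ser f) = 0.
Proof.
move=> k0; apply: ps_ext => m; rewrite /ps_deriv /A_ser.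
case: forallP => [/(_ k)|]; last by rewrite scaler0.
by rewrite k0 /mi_up eqxx.
Qed.

Lemma D5_B_ser : D 5 (B_ser f) = 0.
Proof.
apply: ps_ext => m; rewrite /D /ps_deriv /B_ser.
by rewrite {1}/mi_up eqxx /= scaler0.
Qed.

Definition mi_pow0 n : mindex := fun k => if k == uk 0 then n else 0%N.

Lemma A_ser_pow0 n : A_ser f (mi_pow0 n) = f (inl n).
Proof.
rewrite /A_ser /mi_pow0 eqxx.
by case: forallP => // -[] k; apply/implyP => /negPf ->.
Qed.

Lemma mi_up_pow0 n : mi_up (mi_pow0 n) (uk 0) = mi_pow0 n.+1.
Proof. by apply: mi_ext => k; rewrite /mi_up /mi_pow0; case: (k == uk 0). Qed.

Lemma D_pow0 (x : S) n : D 0 x (mi_pow0 n) = n.+1%:R *: x (mi_pow0 n.+1).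
Proof. by rewrite /D /ps_deriv mi_up_pow0 /mi_pow0 eqxx. Qed.

Lemma A_ser_cubic n : D 0 (D 0 (D 0 (A_ser f))) = 0 -> f (inl n.+3) = 0.
Proof.
move=> /(congr1 (fun x => x (mi_pow0 n))); rewrite !D_pow0 A_ser_pow0.
by do 3 (move/scaler_cancel=> /(_ (char0 _))).
Qed.

Section Quadratic.
Hypothesis f3 : forall n, f (inl n.+3) = 0.
(** The coefficients of A after re-expansion from powers of u_0 - a_0 to powers of u_0. *)
Local Notation X0 := (f (inl 0%N) - a (uk 0) *: f (inl 1%N)
                      + a (uk 0) ^+ 2 *: f (inl 2%N)).
Local Notation X1 := (f (inl 1%N) - (2%:R * a (uk 0)) *: f (inl 2%N)).
Local Notation X2 := (f (inl 2%N)).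

Lemma ps_lie_quadratic x : L x = l X0 x + U 0 (l X1 x) + U 0 (U 0 (l X2 x)).
Proof.
apply: ps_ext => m; rewrite ps_lie_A.
pose sh n : mindex := fun k => if k == uk 0 then (m k - n)%N else m k.
have sh0 : m = sh 0%N by apply: mi_ext => k; rewrite /sh subn0 if_same.
have shS n : mi_down (sh n) (uk 0) = sh n.+1.
  by apply: mi_ext => k; rewrite /mi_down /sh; case: eqP => // _; rewrite subnS.
rewrite -[RHS]/(l X0 x m + U 0 (l X1 x) m + U 0 (U 0 (l X2 x)) m).
rewrite [in RHS]sh0 /U /ps_mulu !shS /l /ps_ad /sh !eqxx !lieE subn0 -/(sh _).
have -> : (0 < m (uk 0) - 1)%N = (1 < m (uk 0))%N by rewrite subn_gt0.
(* The convolution has at most three nonzero terms, and fewer are available when the exponent of u_0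
   is 0 or 1. *)
case E : (m (uk 0)) => [|[|n]].
- by rewrite big_ord_recl big_ord0 /= -/(sh 0%N) -sh0; lmod_eq K M by ring.
- rewrite !big_ord_recl big_ord0 /= -/(sh 0%N) -/(sh 1%N) -sh0.
  by lmod_eq K M by ring.
rewrite !big_ord_recl big1 /= => [|i _]; last by rewrite f3 lie0x.
rewrite -/(sh 0%N) -/(sh 1%N) -/(sh 2%N) -sh0.
by lmod_eq K M by ring.
Qed.

(** Integration in two rounds: the third derivative of A vanishes, so the second is constant, and
    then so is the first minus its linear part. The constants are read at the zero multi-index. *)
Lemma D0_A_quadratic : D 0 (A_ser f) = C X1 + 2%:R *: U 0 (C X2).
Proof.
have Dk k (x : S) : ps_deriv k x = 0 -> ps_deriv k (D 0 x) = 0.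
  by move=> kx; rewrite /D ps_derivC kx (linf0 (@ps_deriv_linear K M (uk 0))).
have mi00 : mi0 = mi_pow0 0 by apply: mi_ext => k; rewrite /mi_pow0 if_same.
have D3 : D 0 (D 0 (D 0 (A_ser f))) = 0.
  apply: ps_ext => m; rewrite /D /ps_deriv !scalerA.
  rewrite [A_ser _ _](_ : _ = 0) ?scaler0 // /A_ser; case: ifP => // _.
  by rewrite /mi_up eqxx f3.
have D2 : D 0 (D 0 (A_ser f)) = C (2%:R *: X2).
  rewrite [LHS](@ps_deriv0_const K M char0) => [|k].
    rewrite mi00 !D_pow0 A_ser_pow0 /C; congr ps_const; lmod_eq K M by ring.
  have [->|k0] := eqVneq k (uk 0); first exact: D3.
  by rewrite !Dk // D_A_ser.
have at0 : (D 0 (A_ser f) - 2%:R *: U 0 (C X2)) mi0 = X1.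
  rewrite mi00 -[LHS]/(D 0 (A_ser f) (mi_pow0 0) - 2%:R *: U 0 (C X2) (mi_pow0 0)).
  rewrite D_pow0 A_ser_pow0 /U /ps_mulu [in (0 < _)%N]/mi_pow0 if_same -mi00 /C.
  by rewrite ps_const_at0 ltnn addr0; lmod_eq K M by ring.
have : D 0 (A_ser f) - 2%:R *: U 0 (C X2) = C X1.
  rewrite [LHS](@ps_deriv0_const K M char0) => [|k].
    by rewrite at0.
  rewrite (linfD (@ps_deriv_linear K M k)) (linfN (@ps_deriv_linear K M k)).
  rewrite (linfZ (@ps_deriv_linear K M k)) /U ps_deriv_mulu.
  rewrite /C ps_deriv_const (linf0 (@ps_mulu_linear K M a (uk 0))) add0r.
  have [->|k0] := eqVneq k (uk 0).
    rewrite -/(D 0) D2 scale1r (linfZ Clin) subrr //.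
  by rewrite Dk ?D_A_ser // scale0r scaler0 subr0.
by move/eqP; rewrite subr_eq => /eqP.
Qed.
End Quadratic.
End Family.

Definition mi_of (j : {ffun 'I_5 -> nat}) : mindex :=
  fun k => if insub (val k) is Some i then j i else 0%N.

(** The solution attached to a triple (A_0, A_1, Y): A = A_0 + u_0 A_1, expanded about a_0, and the
    coefficients of [B_poly]. *)
Definition WE_family (t : 'I_3 -> M) (x : WEgen) : M :=
  match x with
  | inl 0%N => t (inord 0) + a (uk 0) *: t (inord 1)
  | inl 1%N => t (inord 1)
  | inl _ => 0
  | inr j => B_poly U C alpha beta (t (inord 0)) (t (inord 1)) (t (inord 2)) (mi_of j)
  end.

Lemma mi_of_widen m : m (uk 5) = 0%N ->
  mi_of [ffun i : 'I_5 => m (widen_ord (leqnSn 5) i)] = m.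
Proof.
move=> m5; apply: mi_ext => k; rewrite /mi_of.
case: insubP => [i _ ik|]; first by rewrite ffunE; congr m; apply: val_inj.
rewrite -leqNgt => k5; rewrite -m5; congr m; apply: val_inj; rewrite /= inordK //.
by apply/eqP; rewrite eqn_leq k5 -ltnS ltn_ord.
Qed.

Lemma mi_of5 j : mi_of j (uk 5) = 0%N.
Proof. by rewrite /mi_of insubF //= inordK. Qed.

Lemma B_ser_mi_of (f : WEgen -> M) j : B_ser f (mi_of j) = f (inr j).
Proof.
rewrite /B_ser mi_of5 eqxx; congr (f (inr _)); apply/ffunP => i.
rewrite ffunE /mi_of; case: insubP => [i' _ e|]; last by rewrite /= ltn_ord.
by congr (j _); apply: val_inj.
Qed.

Lemma B_ser_family t : B_ser (WE_family t) =
  B_poly U C alpha beta (t (inord 0)) (t (inord 1)) (t (inord 2)).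
Proof.
apply: ps_ext => m; rewrite /B_ser; case: eqP => [m5|/eqP m5].
  by rewrite /WE_family mi_of_widen.
(* [B_ser] is zero by definition at a positive exponent of u_5; so is [B_poly], because its
   derivative by u_5 vanishes. *)
apply/esym; apply: (@scaler_cancel _ _ (m (uk 5))%:R).
  by case: (m (uk 5)) m5 => // n _; exact: char0.
have := congr1 (fun x => x (mi_down m (uk 5)))
  (D5_B_poly Dlin Ulin DU DC alpha beta (t (inord 0)) (t (inord 1)) (t (inord 2))).
have m5_gt0 : (0 < m (uk 5))%N by rewrite lt0n.
by rewrite /D /ps_deriv mi_downK // /mi_down eqxx prednK.
Qed.

Lemma WE_family_rel t : h_rel alpha beta t -> WE_rel alpha beta a (WE_family t).
Proof.
move=> [R1 R2 R3 R4 [R5 R6]]; apply/WE_relE; rewrite B_ser_family.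
have f3 n : WE_family t (inl n.+3) = 0 by [].
have e0 : t (inord 0) + a (uk 0) *: t (inord 1) - a (uk 0) *: t (inord 1)
    + a (uk 0) ^+ 2 *: (0 : M) = t (inord 0).
  by lmod_eq K M by ring.
have e1 : t (inord 1) - (2%:R * a (uk 0)) *: 0 = t (inord 1).
  by rewrite scaler0 subr0.
have LX x : ps_lie (A_ser (WE_family t)) x =
    l (t (inord 0)) x + U 0 (l (t (inord 1)) x).
  rewrite (ps_lie_quadratic f3) /= e0 e1.
  have -> : l 0 x = 0 by apply: ps_ext => m; exact: lie0x.
  by rewrite !(linf0 (Ulin 0)) addr0.
have A1X : D 0 (A_ser (WE_family t)) = C (t (inord 1)).
  rewrite (D0_A_quadratic f3) /= e1.
  by rewrite (linf0 Clin) (linf0 (Ulin 0)) scaler0 addr0.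
rewrite (WE_B_poly char0 Dlin Ulin DU UU Clin llin DC lU lC beta R1 R2 _ LX A1X).
by rewrite R3 R4 R5 R6 scaler0 (linf0 Clin) !(linf0 (Ulin 0)) !addr0.
Qed.

Lemma B_polyD0 X0 X1 Y :
  B_poly U C alpha beta X0 X1 Y = B_poly U C alpha beta X0 X1 0 + C Y.
Proof. by rewrite /B_poly (linf0 Clin) addr0. Qed.

Hypothesis H6 : 6%:R * alpha + beta != 0.

Lemma WE_solution (f : WEgen -> M) : WE_rel alpha beta a f ->
  exists2 t, h_rel alpha beta t & f =1 WE_family t.
Proof.
move=> /WE_relE WE.
have DLA k (x : S) : (0 < k < 6)%N ->
    D k (ps_lie (A_ser f) x) = ps_lie (A_ser f) (D k x).
  by case/andP=> k0 k6; apply: ps_deriv_lie_A; rewrite uk_eq // gtn_eqF.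
have DA1 k : (0 < k < 6)%N -> D k (D 0 (A_ser f)) = 0.
  case/andP=> k0 k6; rewrite DD {2}/D D_A_ser ?(linf0 (Dlin 0)) //.
  by rewrite uk_eq // gtn_eqF.
have D5B := D5_B_ser f.
have [A3_0 _] := WE_A3 char0 Dlin Ulin DU DD (@ps_lie_A_linear f) DLA DA1
  erefl erefl D5B WE.
have f3 n : f (inl n.+3) = 0 by apply: A_ser_cubic.
have LX := ps_lie_quadratic f3; have A1X := D0_A_quadratic f3.
set X0 := f (inl 0%N) - _ + _ in LX.
set X1 := f (inl 1%N) - _ in LX A1X.
set X2 := f (inl 2%N) in LX A1X.
have X2_0 : X2 = 0.
  apply: (quadratic_coef0 char0 Dlin Ulin DU DD UU Clin llin DC Cinj lU lD lC
    LX A1X D5B WE).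
  (* For the coefficients of this equation 2 q - p = 2 (6 alpha + beta). *)
  rewrite (_ : _ - _ = 2%:R * (6%:R * alpha + beta)); last by ring.
  by rewrite mulf_neq0 // char0.
have [R1 R2'] := linear_coef_rel char0 Dlin Ulin DU DD UU Clin llin DC Cinj lU lD lC
    LX A1X D5B WE X2_0.
have R2 : (4%:R * alpha) *: lie X0 X1 + lie X0 (lie X1 (lie X0 X1)) = 0.
  (* Here 3 q - p = 20 alpha, so the relation obtained is five times the second relation of h. *)
  apply: (@scaler_cancel _ _ 5%:R); first exact: char0.
  by rewrite -[RHS]R2'; lmod_eq K M by ring.
pose T := B_ser f - B_poly U C alpha beta X0 X1 0.
have TC : T = C (T mi0).
  apply: ps_deriv0_const => // k; rewrite -[k]inord_val.
  exact: (D_B_poly char0 Dlin Ulin DU DD UU Clin llin DC Cinj lU lD lC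
    LX A1X D5B WE X2_0 R1 R2 erefl erefl erefl (ltn_ord k)).
set Y := T mi0 in TC.
have BE : B_ser f = B_poly U C alpha beta X0 X1 Y.
  by rewrite B_polyD0 -TC /T addrC subrK.
have LX' x : ps_lie (A_ser f) x = l X0 x + U 0 (l X1 x).
  rewrite LX X2_0; have -> : l 0 x = 0 by apply: ps_ext => m; exact: lie0x.
  by rewrite !(linf0 (Ulin 0)) addr0.
have A1X' : D 0 (A_ser f) = C X1.
  by rewrite A1X X2_0 (linf0 Clin) (linf0 (Ulin 0)) scaler0 addr0.
move: WE; rewrite BE (WE_B_poly char0 Dlin Ulin DU UU Clin llin DC lU lC beta R1 R2 _ LX' A1X').
move=> /(const_poly3 char0 Dlin Ulin DU Clin DC Cinj)[R6 R5 R4 R3'].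
have R3 : lie X1 (lie X1 (lie X0 (lie X0 (lie X0 X1)))) = 0.
  by apply: scaler_cancel R3'; rewrite invr_eq0 char0.
exists (fun i => [:: X0; X1; Y]`_i).
  by rewrite /h_rel !inordK.
rewrite /WE_family !inordK //=.
case=> [[|[|[|n]]]|j] //=.
- by rewrite /X0 /X1 -/X2 X2_0; lmod_eq K M by ring.
- by rewrite /X1 -/X2 X2_0 scaler0 subr0.
- by rewrite -BE B_ser_mi_of.
Qed.

(** A determines A_0 and A_1; these determine [B_poly] up to its constant Y, which the coefficient
    of B at the zero multi-index then reveals. *)
Lemma WE_family_inj t t' : WE_family t =1 WE_family t' -> t =1 t'.
Proof.
move=> e; have e1 : t (inord 1) = t' (inord 1) := e (inl 1%N).
have e0 : t (inord 0) = t' (inord 0).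
  by have := e (inl 0%N); rewrite /= e1 => /addIr.
have e2 : t (inord 2) = t' (inord 2).
  have := e (inr [ffun=> 0%N]); rewrite /= e0 e1 B_polyD0 [in RHS]B_polyD0.
  have -> : mi_of [ffun=> 0%N] = mi0.
    by apply: mi_ext => k; rewrite /mi_of; case: insub => // i; rewrite ffunE.
  move=> /addrI; by rewrite /C !ps_const_at0.
move=> k; rewrite -[k]inord_val.
by case: k => [[|[|[|//]]] lt_k].
Qed.
End OneAlgebra.

(** [B_poly] is built from linear operations, multiplications by u_k, constants and brackets, all of
    which commute with [phi] applied coefficientwise. *)
Lemma WE_family_natural (M N : lieAlgType K) (phi : M -> N) (t : 'I_3 -> M) x :
  lie_hom phi -> phi (WE_family t x) = WE_family (phi \o t) x.
Proof.
move=> Hphi; case: x => [[|[|n]]|j] //.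
- by rewrite /= !(lie_homE Hphi).
- exact: lie_hom0.
pose P (x : mindex -> M) : mindex -> N := fun m => phi (x m).
have PD x y : P (x + y) = P x + P y by apply: ps_ext => m; exact: (lie_homD Hphi).
have PN x : P (- x) = - P x by apply: ps_ext => m; exact: (lie_homN Hphi).
have PZ c x : P (c *: x) = c *: P x by apply: ps_ext => m; exact: (lie_homZ Hphi).
have PU k x : P (ps_mulu a k x) = ps_mulu a k (P x).
  apply: ps_ext => m; rewrite /P /ps_mulu !(lie_homE Hphi).
  by case: ifP; rewrite ?(lie_hom0 Hphi).
have PC X : P (@ps_const K M X) = @ps_const K N (phi X).
  by apply: ps_ext => m; rewrite /P /ps_const; case: ifP; rewrite ?(lie_hom0 Hphi).
pose BM := B_poly (fun k => @ps_mulu K M a (uk k)) (@ps_const K M) alpha beta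
  (t (inord 0)) (t (inord 1)) (t (inord 2)).
rewrite -[LHS]/(P BM (mi_of j)); congr (_ (mi_of j)).
by rewrite /BM /B_poly !(PD, PN, PZ, PU, PC) !(lie_homL Hphi).
Qed.
End FormalSolutions.

(** * Comparison of the two presentations and the theorem *)

(** A Yoneda argument: [WE_family] is a natural bijection between solutions of the two systems. The
    universal solution in W comes from a triple [t], which gives h -> W, and the family attached to
    [g] gives W -> h. One composite is the identity by naturality, the other by naturality and
    injectivity. *)
Lemma WE_isomorphic_h (K : fieldType) (char0 : forall n : nat, n.+1%:R != 0 :> K)
  (alpha beta : K) (a : 'I_6 -> K) (H6 : 6%:R * alpha + beta != 0)
  (W : lieAlgType K) (gW : WEgen -> W) (h : lieAlgType K) (g : 'I_3 -> h) :
  presents (@WE_rel K alpha beta a) gW -> presents (@h_rel K alpha beta) g ->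
  lie_isomorphic W h.
Proof.
move=> HW Hh; have [RW univW] := HW; have [Rh univh] := Hh.
have [t Rt gWt] := WE_solution char0 H6 RW.
have [phi [Hphi phig _]] := univh W t Rt.
have [psi [Hpsi psigW _]] := univW h _ (WE_family_rel char0 a Rh).
exists psi; split=> //; exists phi.
- apply: (presents_id HW (lie_hom_comp Hpsi Hphi)) => x /=.
  rewrite psigW WE_family_natural // gWt.
  by congr (WE_family alpha beta a _ x); apply: funext.
- apply: (presents_id Hh (lie_hom_comp Hphi Hpsi)) => x /=; rewrite phig.
  apply: (WE_family_inj (alpha := alpha) (beta := beta) (a := a)
    (t := fun i => psi (t i))) => y.
  by rewrite -(WE_family_natural _ _ _ _ _ Hpsi) -gWt psigW.
Qed.

Lemma KK_char0 (R : realType) (b : bool) n : n.+1%:R != 0 :> KK R b.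
Proof. by case: b; rewrite /KK pnatr_eq0. Qed.

Theorem theorem4p7 (R : realType) (b : bool) (alpha beta : KK R b)
  (a : 'I_6 -> KK R b)
  (H1 : alpha + beta != 0) (H6 : 6%:R * alpha + beta != 0)
  (H16 : 16%:R * alpha + beta != 0)
  (W : lieAlgType (KK R b)) (gW : WEgen -> W)
  (HW : presents (@WE_rel (KK R b) alpha beta a) gW)
  (h : lieAlgType (KK R b)) (g : 'I_3 -> h)
  (Hh : presents (@h_rel (KK R b) alpha beta) g) :
  let A0 := g (inord 0) in let A1 := g (inord 1) in let Y := g (inord 2) in
  [/\ lie_isomorphic W h,
      alpha != 0 ->
        @sl2_plus_K3 _ h
          [:: lie A0 A1; lie A0 (lie A0 A1); lie A1 (lie A0 A1)]
          [:: Y; - (4%:R * alpha) *: A0 + lie A0 (lie A0 A1);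
                 (4%:R * alpha) *: A1 + lie A1 (lie A0 A1)] &
      alpha = 0 -> nilpotent h /\ dim_le h 6].
Proof.
have char0 : forall n : nat, n.+1%:R != 0 :> KK R b by exact: KK_char0.
split; first exact: (WE_isomorphic_h char0 H6 HW Hh).
  exact: (h_decomposition char0 H1 H6 H16 Hh).
move=> alpha0; split; last exact: (h_dim_le6 char0 H1 H6 H16 Hh).
exact: (h_nilpotent char0 H1 H6 H16 Hh alpha0).
Qed.
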